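(* Let $d\ge1$. Let $T$ be a positive random variable with $\mathbf{P}[T\le\frac12]=1$ and such that, for some $c>0$, $\mathbf{P}[T^{-1}\ge n]\ge c\,n^{-1/2^d}$ for all integers $n\ge1$. Let $B_0$ be independent of $T$ and uniform on the $2^d$ sets of the form $\{s_1e_1,\dots,s_de_d\}$, $s_i\in\{-1,1\}$, where $e_1,\dots,e_{d+1}$ is the canonical basis of $\mathbb{Z}^{d+1}$. Let $\mathbf{Q}^{\mathrm{ex}}$ be the law of the i.i.d. environment on $\mathbb{Z}^{d+1}$ in which the transition probabilities at a site are distributed as $$q^\omega(0,e)=\begin{cases}\frac{T}{C(T,d)} & \text{if } e\in B_0,\\ \frac{1-T}{C(T,d)} & \text{if } -e\in B_0,\\ \frac{2T}{C(T,d)} & \text{if } e=e_{d+1},\\ \frac{T}{C(T,d)} & \text{if } e=-e_{d+1},\end{cases}$$ where $C(T,d)$ is the normalizing constant making $q^\omega(0,\cdot)$ a probability. Let $(X_n)$ be the random walk in the random environment with law $\mathbf{Q}^{\mathrm{ex}}$, started at $0$, with annealed law $\mathbb{P}$. Then: (1) $X_n$ is transient in the direction $e_{d+1}$, i.e. $\mathbb{P}[\lim_{n\to\infty}X_n\cdot e_{d+1}=\infty]=1$; (2) $X_n$ has zero velocity, i.e. $X_n/n\to\vec 0$ $\mathbb{P}$-a.s. If furthermore $d\ge2$, then there exists $C(d)<\infty$ such that $$\lim_{n\to\infty}\mathbb{P}\bigl[\text{there exists } i\in[0,n] \text{ such that } |\{X_j:\ j\in[i,i+C(d)\ln n]\}|=2\bigr]=0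 .$$
   Context: A random walk in an i.i.d. random environment on $\mathbb{Z}^{d+1}$: the environment $\omega$ is a family of probability vectors $q^\omega(x,\cdot)$ on the $2(d+1)$ canonical unit vectors, i.i.d. over $x\in\mathbb{Z}^{d+1}$; given $\omega$, $(X_n)$ is the nearest-neighbour Markov chain started at $0$ which jumps from $x$ to $x+e$ with probability $q^\omega(x,e)$ (quenched law $P^\omega$); the annealed law is $\mathbb{P}=\int P^\omega\,d\mathbf{Q}^{\mathrm{ex}}(\omega)$. Indices $i,j$ in the last display are integers, and $|\cdot|$ denotes cardinality. *)

(* Defs.v *)
From HB Require Import structures.
From mathcomp Require Import all_boot all_order all_algebra.
From mathcomp Require Import all_classical all_reals all_analysis.

Set Implicit Arguments.
Unset Strict Implicit.
Unset Printing Implicit Defensive.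

Import Order.TTheory GRing.Theory Num.Theory.
Import numFieldNormedType.Exports.

Local Open Scope classical_set_scope.
Local Open Scope ring_scope.

Notation site D := 'rV[int]_D.

(* The 2 D unit vectors: (i, true) encodes e_i and (i, false) encodes - e_i. *)
Definition dir (D : nat) : finType := ('I_D * bool)%type.

Definition unitvec (D : nat) (e : dir D) : site D :=
  if e.2 then delta_mx 0 e.1 else - delta_mx 0 e.1.

Definition oppdir (D : nat) (e : dir D) : dir D := (e.1, ~~ e.2).

Definition prodspace (I : Type) (disp : measure_display)
  (T : measurableType disp) : Type := I -> T.

Definition cylinders (I : Type) (disp : measure_display)
    (T : measurableType disp) : set (set (prodspace I T)) :=
  [set A | exists i (B : set T), measurable B /\ A = [set f | B (f i)]].

Definition prod_display (disp : measure_display) : measure_display.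
Proof. exact: disp. Qed.

HB.instance Definition _ (I : Type) (disp : measure_display)
    (T : measurableType disp) := Choice.copy (prodspace I T) (I -> T).
HB.instance Definition _ (I : Type) (disp : measure_display)
    (T : measurableType disp) := isPointed.Build (prodspace I T) (fun=> point).
HB.instance Definition _ (I : Type) (disp : measure_display)
    (T : measurableType disp) :=
  @isMeasurable.Build (prod_display disp) (prodspace I T)
    <<s @cylinders I disp T >> (@sigma_algebra0 _ setT _)
    (@sigma_algebraC _ _) (@sigma_algebra_bigcup _ setT _).

Definition transition (R : realType) (D : nat) := prodspace (dir D) R.

Definition environment (R : realType) (D : nat) :=
  prodspace (site D) (transition R D).

(* Trajectories of the walk, with the product over the times n of the discrete
   sigma-algebra on Z^D; as Z^D is countable, it is generated by the sets
   {X_n = x}. *)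
Definition path_space (D : nat) : Type := nat -> site D.

Definition path_cylinders (D : nat) : set (set (path_space D)) :=
  [set A | exists n x, A = [set X | X n = x]].

Definition path_display : measure_display.
Proof. exact: default_measure_display. Qed.

HB.instance Definition _ (D : nat) :=
  Choice.copy (path_space D) (nat -> site D).
HB.instance Definition _ (D : nat) :=
  isPointed.Build (path_space D) (fun=> 0).
HB.instance Definition _ (D : nat) :=
  @isMeasurable.Build path_display (path_space D)
    <<s @path_cylinders D >> (@sigma_algebra0 _ setT _)
    (@sigma_algebraC _ _) (@sigma_algebra_bigcup _ setT _).

Definition is_environment (R : realType) (D : nat) (w : environment R D) :=
  forall x, (forall e, 0 <= w x e) /\ \sum_(e : dir D) w x e = 1.

Definition iid_environment (R : realType) (D : nat)
    (mu : set (transition R D) -> \bar R)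
    (Q : probability (environment R D) R) : Prop :=
  forall (s : seq (site D)) (A : site D -> set (transition R D)),
    uniq s -> (forall x, measurable (A x)) ->
    Q [set w | forall x, x \in s -> A x (w x)]
      = (\prod_(x <- s) mu (A x))%E.

(* P is the law of the Markov chain started at 0 which jumps from x to x + e
   with probability w x e. *)
Definition quenched_law (R : realType) (D : nat) (w : environment R D)
    (P : set (path_space D) -> \bar R) : Prop :=
  P [set X | X 0%N = 0] = 1%E /\
  forall (n : nat) (x : nat -> site D) (e : dir D),
    P [set X | (forall i, (i <= n)%N -> X i = x i) /\
               X n.+1 = x n + unitvec e]
    = (P [set X | forall i, (i <= n)%N -> X i = x i] * (w (x n) e)%:E)%E.

(* The quenched laws form a measurable family indexed by the environment.  The
   type environment R D also contains families that are not probability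
   vectors, at which the kernel is arbitrary. *)
Definition quenched_kernel (R : realType) (D : nat)
    (K : R.-pker (environment R D) ~> (path_space D)) : Prop :=
  forall w, is_environment w -> quenched_law w (K w).

Definition annealed (R : realType) (D : nat)
    (Q : probability (environment R D) R)
    (K : R.-pker (environment R D) ~> (path_space D))
    (A : set (path_space D)) : \bar R :=
  (\int[Q]_w K w A)%E.

(* The set {s_1 e_1, ..., s_d e_d}; the last coordinate ord_max of 'I_d.+1
   stands for the direction e_(d+1). *)
Definition signset (d : nat) (s : {ffun 'I_d -> bool}) : {set dir d.+1} :=
  [set (widen_ord (leqnSn d) i, s i) | i : 'I_d].

(* The final 0 is never reached when B is one of the sets signset s. *)
Definition ex_weight (R : realType) (d : nat) (t : R) (B : {set dir d.+1})
    (e : dir d.+1) : R :=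
  if e \in B then t
  else if oppdir e \in B then 1 - t
  else if e == (ord_max, true) then 2 * t
  else if e == (ord_max, false) then t
  else 0.

Definition ex_norm (R : realType) (d : nat) (t : R) (B : {set dir d.+1}) : R :=
  \sum_(e : dir d.+1) ex_weight t B e.

Definition ex_transition (R : realType) (d : nat) (t : R)
    (B : {set dir d.+1}) : transition R d.+1 :=
  fun e => ex_weight t B e / ex_norm t B.

Record ex_variables (R : realType) (d : nat) (disp : measure_display)
    (Omega : measurableType disp) (Pr : probability Omega R)
    (T : {RV Pr >-> R}) (B0 : Omega -> {set dir d.+1}) : Prop := {
  ex_T_pos : Pr [set o | 0 < T o] = 1%E ;
  ex_T_le_half : Pr [set o | T o <= 2^-1] = 1%E ;
  ex_T_tail : exists2 c : R, 0 < c &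
    forall n : nat, (1 <= n)%N ->
      ((c * n%:R `^ (- (2 ^ d)%:R^-1))%:E
        <= Pr [set o | n%:R <= (T o)^-1]%R)%E ;
  ex_B0_measurable : forall S : set {set dir d.+1}, measurable (B0 @^-1` S) ;
  ex_B0_uniform : forall s : {ffun 'I_d -> bool},
    Pr (B0 @^-1` [set signset s]) = ((2 ^ d)%:R^-1)%:E ;
  ex_independent : forall (A : set R) (S : set {set dir d.+1}),
    measurable A ->
    Pr (T @^-1` A `&` B0 @^-1` S)
      = (Pr (T @^-1` A) * Pr (B0 @^-1` S))%E
}.

Definition ex_marginal (R : realType) (d : nat) (disp : measure_display)
    (Omega : measurableType disp) (Pr : probability Omega R)
    (T : {RV Pr >-> R}) (B0 : Omega -> {set dir d.+1})
    (A : set (transition R d.+1)) : \bar R :=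
  pushforward Pr (fun o => ex_transition (T o) (B0 o)) A.

Definition transient_up (R : realType) (d : nat) : set (path_space d.+1) :=
  [set X | (X n ord0 ord_max)%:~R @[n --> \oo] --> (+oo%R : set_system R)].

Definition zero_velocity (R : realType) (D : nat) : set (path_space D) :=
  [set X | (n%:R^-1 : R) *: map_mx intr (X n) @[n --> \oo]
             --> (0 : 'rV[R]_D)].

Definition two_site_stay (R : realType) (D : nat) (C : R) (n : nat) :
    set (path_space D) :=
  [set X | exists2 i, (i <= n)%N &
     ([set X j | j in [set j | (i <= j)%N /\ j%:R <= i%:R + C * ln n%:R]]
       #= `I_2)%card].

(* Main.v *)
Require Import Defs.
From HB Require Import structures.
From mathcomp Require Import all_boot all_order all_algebra.
From mathcomp Require Import all_classical all_reals all_analysis.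
From mathcomp Require Import measurable_realfun.
From mathcomp Require Import ring lra zify.

Set Implicit Arguments.
Unset Strict Implicit.
Unset Printing Implicit Defensive.

Import Order.TTheory GRing.Theory Num.Theory.
Import numFieldNormedType.Exports.

Local Open Scope classical_set_scope.
Local Open Scope ring_scope.

(** The proof treats three phenomena separately.

Transience. In every environment of the model, the walk leaves [x] upwards with twice the
probability [u x] with which it leaves [x] downwards. Hence the mean of
(4/3)^(- height) decreases at each step by the fraction [u / 6], and the sum
over time of the means of [u] times this potential is at most 6
([green_bound]). So each site is visited finitely often. Besides, when the
walk arrives at a site where it has never been, its path so far does not
involve the transition at that site, which is a fresh sample; averaging the
same bound over the environment shows that the expected number of sites
visited below a given height is finite ([new_below_summable]). Thus the walk
is finitely often below any height.

Zero velocity. Cut the lattice into horizontal blocks of side 2. A block is a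
trap of depth [m] if at each of its 2^d sites the signs push the walk back
into the block and [T] is at most of order [1 / m]: then the walk spends there
a time of order [m]. The exponent 1 / 2^d in the tail of [T] is such that a
block is a trap of depth [m] with probability at least [c / m]
([block_trapping]), so the time spent in a block has infinite mean. Let [L] be
plus or minus the integer part of half a coordinate. When [L] first reaches
the value [k], the block where this happens is unexplored, so the time tau_k
of this event satisfies E[z^tau_k] <= phi^k, where [phi] is a bound on the
Laplace transform at [z] of the time spent in a fresh block
([integral_hit_geometric]). Because of the infinite mean, for each [A] some z
< 1 has phi < z^A ([trap_parameters]); then tau_k <= A k has a probability
exponentially small in [k]. By the Borel-Cantelli lemma each of the 2 (d + 1)
levels is eventually below [n / A], for all [A].

Two sites. A walk that stays on two sites during [k + 1] steps turns back [k]
times. For d >= 2 a given direction has probability at most [1 / d <= 1 / 2],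
so this has probability at most 2^(- k), and a union bound over the starting
times concludes ([two_site_cvg]).

The means above are computed by a recursion on the first step, [expect], which
is matched with the law of the chain in [quenched_hist]. All uses of the
independence of the environment reduce to [integral_indep]: a function of the
environment outside a finite set of sites is independent of an event bearing
on these sites. *)

(** * Measurability, null sets and elementary inequalities *)

Lemma measurable_le_set (disp : measure_display) (T : measurableType disp)
    (R : realType) (f g : T -> R) :
  measurable_fun setT f -> measurable_fun setT g ->
  measurable [set x | f x <= g x].
Proof.
by move=> mf mg; rewrite -[X in measurable X]setTI; exact: measurable_fun_le.
Qed.

Lemma measurable_funV_real (disp : measure_display) (T : measurableType disp)
    (R : realType) (f : T -> R) :
  measurable_fun setT f -> measurable_fun setT (fun x => (f x)^-1).
Proof.
(* real powers of nonnegative numbers are measurable *)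
move=> mf; have -> : (fun x => (f x)^-1) =
    (fun x => f x * ((f x * f x) `^ (-1))).
  apply/funext => x; rewrite powR_inv1 -?expr2 ?sqr_ge0// expr2.
  have [->|fx] := eqVneq (f x) 0; first by rewrite invr0 mul0r.
  by rewrite invfM mulrA mulfV// mul1r.
apply: measurable_funM => //.
apply: (measurableT_comp (measurable_powR _)); exact: measurable_funM.
Qed.

Lemma measurable_proj (I : Type) (disp : measure_display)
    (T : measurableType disp) (i : I) :
  measurable_fun setT (fun f : prodspace I T => f i).
Proof.
move=> _ B mB; rewrite setTI; apply: sub_sigma_algebra.
by exists i, B.
Qed.

Lemma measurable_fun_prod (I : Type) (disp disp' : measure_display)
    (T : measurableType disp) (X : measurableType disp')
    (g : X -> prodspace I T) :
  (forall i, measurable_fun setT (fun x => g x i)) -> measurable_fun setT g.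
Proof.
move=> mg; apply: (@measurability _ _ _ _ _ _ (@cylinders I disp T)) => //.
move=> _ [_ [i [B [mB ->]] <-]].
have := mg i measurableT B mB; rewrite !setTI => h.
exact: h.
Qed.

Lemma bigcup_measurable_countType (disp : measure_display)
    (T : measurableType disp) (I : countType) (P : set I) (F : I -> set T) :
  (forall i, measurable (F i)) -> measurable (\bigcup_(i in P) F i).
Proof.
move=> mF; pose G n := if unpickle n is Some i
  then if `[< P i >] then F i else set0 else set0.
rewrite (_ : \bigcup_(i in P) _ = \bigcup_n G n).
  by apply: bigcup_measurable => n _; rewrite /G; case: unpickle => // i; case:
    ifP.
apply/seteqP; split=> x [i].
  move=> Pi Fx; exists (pickle i) => //; rewrite /G pickleK.
  by rewrite asboolT.
rewrite /G; case: unpickle => // j _; case: ifPn => // /asboolP Pj Fx.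
by exists j.
Qed.

Lemma measure_bigcup_finType (disp : measure_display)
    (T : measurableType disp) (R : realType) (m : {measure set T -> \bar R})
    (I : finType) (F : I -> set T) :
  (forall i, measurable (F i)) -> trivIset setT F ->
  m (\bigcup_i F i) = (\sum_i m (F i))%E.
Proof.
move=> mF tF; rewrite measure_fin_bigcup//; last exact: finite_finset.
rewrite [RHS]fsbig_seq ?index_enum_uniq//; apply: eq_fsbigl.
by apply/seteqP; split=> i //= _; rewrite mem_index_enum.
Qed.

Lemma negligible_bigcup_countType (disp : measure_display)
    (T : measurableType disp) (R : realType) (m : {measure set T -> \bar R})
    (I : countType) (F : I -> set T) :
  (forall i, m.-negligible (F i)) -> m.-negligible (\bigcup_i F i).
Proof.
move=> F0; pose G n := if unpickle n is Some i then F i else set0.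
have -> : \bigcup_i F i = \bigcup_n G n.
  apply/seteqP; split=> x [i _]; rewrite /G.
    by move=> Fx; exists (pickle i) => //; rewrite pickleK.
  by case: unpickle => // j Fx; exists j.
apply: negligible_bigcup => n; rewrite /G; case: unpickle => //.
exact: negligible_set0.
Qed.

Lemma nneseries_le_bound (R : realType) (u : nat -> \bar R) (M : \bar R) :
  (forall n, 0 <= u n)%E -> (forall N, \sum_(n < N) u n <= M)%E ->
  (\sum_(n <oo) u n <= M)%E.
Proof.
move=> u0 uM; apply: lime_le; first exact: is_cvg_nneseries.
by apply: nearW => N; rewrite big_mkord.
Qed.

Lemma bernoulli_ineq (R : realType) (a : R) n : 0 <= a <= 1 ->
  1 - n%:R * a <= (1 - a) ^+ n.
Proof.
move=> /andP[a0 a1]; elim: n => [|n IH]; first by rewrite mul0r subr0.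
rewrite exprS; apply: le_trans (ler_wpM2l _ IH); last by rewrite subr_ge0.
have : 0 <= n%:R :> R by [].
by rewrite -natr1; nra.
Qed.

Lemma prode_ge (R : realType) (I : eqType) (s : seq I) (F : I -> \bar R) (p :
  R) : 0 <= p ->
  (forall i, (p%:E <= F i)%E) -> ((p ^+ size s)%:E <= \prod_(i <- s) F i)%E.
Proof.
move=> p0 pF; elim: s => [|i s IH]; first by rewrite big_nil.
by rewrite big_cons exprS EFinM; apply: lee_pmul; rewrite ?lee_fin ?exprn_ge0.
Qed.

(** * Independence of the environment at distinct sites *)

Section independence.
Variables (R : realType) (D : nat) (mu : set (transition R D) -> \bar R).
Variable Q : probability (environment R D) R.
Hypothesis iidQ : iid_environment mu Q.

Definition rect (s : seq (site D)) (A : site D -> set (transition R D)) :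
    set (environment R D) := [set w | forall x, x \in s -> A x (w x)].

Lemma rect_cons x s A : rect (x :: s) A = [set w | A x (w x)] `&` rect s A.
Proof.
apply/seteqP; split=> w /=.
  move=> h; split; first by apply: h; rewrite mem_head.
  by move=> y ys; apply: h; rewrite inE ys orbT.
by move=> [Ax hs] y; rewrite inE => /orP[/eqP ->|/hs].
Qed.

Lemma measurable_rect s A : (forall x, measurable (A x)) ->
  measurable (rect s A).
Proof.
move=> mA; elim: s => [|x s IH].
  by rewrite (_ : rect _ _ = setT) //; apply/seteqP; split.
rewrite rect_cons; apply: measurableI => //.
rewrite -[X in measurable X]setTI.
exact: (@measurable_proj _ _ _ x).
Qed.

(** A function that ignores the sites of [s] factors through [reset s]; this
    turns independence from these sites into an identity between image
    measures. *)
Definition reset (s : seq (site D)) (w : environment R D) : environment R D :=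
  fun x => if x \in s then point else w x.

Lemma measurable_reset s : measurable_fun setT (reset s).
Proof.
apply: measurable_fun_prod => x; rewrite /reset.
have [xs|xs] := boolP (x \in s).
  exact: measurable_cst.
exact: measurable_proj.
Qed.

Definition rects : set (set (environment R D)) :=
  [set E | exists s A, [/\ uniq s, forall x, measurable (A x) & E = rect s A]].

Lemma rects_setI : setI_closed rects.
Proof.
move=> _ _ [s [A [us mA ->]]] [s' [A' [us' mA' ->]]].
exists (undup (s ++ s')), (fun x => (if x \in s then A x else setT) `&`
  (if x \in s' then A' x else setT)); split; first exact: undup_uniq.
  by move=> x; apply: measurableI; case: ifP.
apply/seteqP; split=> w /=.
  move=> [h h'] x _; split; case: ifPn => // xs; first exact: h.
  exact: h'.
move=> h; split=> x xs; have := h x; rewrite mem_undup mem_cat xs ?orbT => /(_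
  isT) [].
  by [].
by [].
Qed.

Lemma measurable_rects :
  (measurable : set (set (environment R D))) = <<s rects >>.
Proof.
apply/seteqP; split.
  apply: sub_smallest2r.
  - exact: smallest_sigma_algebra.
  move=> _ [x [B [mB ->]]]; exists [:: x], (fun=> B); split=> //.
  apply/seteqP; split=> w /=; first by move=> h y; rewrite inE => /eqP ->.
  by apply; rewrite mem_head.
apply: smallest_sub => //; first exact: sigma_algebra_measurable.
by move=> _ [s [A [us mA ->]]]; exact: measurable_rect.
Qed.

(** As functions of [E] both sides are finite measures, so it is enough to
    compare them on rectangles, which are stable under intersection and
    generate the sigma-algebra. There [reset s] either makes the event empty
    or removes the sites of [s] from it. *)
Lemma reset_indep s A E : uniq s -> (forall x, measurable (A x)) ->
  measurable E ->
  Q (reset s @^-1` E `&` rect s A) = (Q (rect s A) * Q (reset s @^-1` E))%E.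
Proof.
move=> us mA mE.
have mrs : measurable (rect s A) by exact: measurable_rect.
have Qfin : (Q (rect s A)) \is a fin_num by exact: fin_num_measure.
have Qge : (0 <= fine (Q (rect s A)))%R by exact/fine_ge0/measure_ge0.
have mr := measurable_reset s.
pose m1 : {measure set _ -> \bar R} :=
  measure_function_pushforward__canonical__measure_function_Measure (mrestr Q
    mrs) mr.
pose p2 : {measure set _ -> \bar R} :=
  measure_function_pushforward__canonical__measure_function_Measure Q mr.
pose m2 : {measure set _ -> \bar R} := mscale (NngNum Qge) p2.
have -> : Q (reset s @^-1` E `&` rect s A) = m1 E by [].
have -> : (Q (rect s A) * Q (reset s @^-1` E))%E = m2 E.
  by rewrite /m2 /= /mscale /= fineK.
apply: (@measure_unique _ _ _ rects (fun=> setT)) => //.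
- exact: measurable_rects.
- exact: rects_setI.
- move=> _; exists [::], (fun=> setT); split=> //.
  by apply/seteqP; split.
- by rewrite bigcup_const.
- move=> _ [s' [A' [us' mA' ->]]].
  rewrite /m1 /m2 /= /mscale /= /p2 /= fineK// /pushforward /mrestr.
  (* on s' the reset environment is the default [point] at the sites of s *)
  have [h|h] := pselect (forall x, x \in s -> x \in s' -> A' x point); last
    first.
    have -> : reset s @^-1` rect s' A' = set0.
      apply/seteqP; split=> w //= hw; apply: h => x xs xs'.
      by have := hw x xs'; rewrite /reset xs.
    by rewrite set0I measure0 mule0.
  pose t := [seq x <- s' | x \notin s].
  have ut : uniq t by exact: filter_uniq.
  have -> : reset s @^-1` rect s' A' = rect t A'.
    apply/seteqP; split=> w /= hw x.
      by rewrite mem_filter => /andP[xs xs']; have := hw x xs'; rewrite /reset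
        (negbTE xs).
    move=> xs'; rewrite /reset; case: ifPn => xs; first exact: h.
    by apply: hw; rewrite mem_filter xs.
  pose B x := if x \in s then A x else A' x.
  have mB x : measurable (B x) by rewrite /B; case: ifP.
  have -> : rect t A' `&` rect s A = rect (s ++ t) B.
    apply/seteqP; split=> w /=.
      move=> [ht hs] x; rewrite mem_cat /B; case: ifPn => [xs _|xs /= xt];
        first exact: hs.
      exact: ht.
    move=> hB; split=> x xt; have := hB x; rewrite mem_cat xt ?orbT => /(_ isT);
      rewrite /B.
      by move: xt; rewrite mem_filter => /andP[/negbTE -> _].
    by rewrite xt.
  have ust : uniq (s ++ t).
    rewrite cat_uniq us ut /= andbT; apply/hasPn => x.
    by rewrite mem_filter => /andP[].
  rewrite /rect (iidQ ust mB) (iidQ us mA) (iidQ ut mA') big_cat /=; congr (_ *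
    _)%E.
    by apply: eq_big_seq => x xs; rewrite /B xs.
  apply: eq_big_seq => x; rewrite mem_filter => /andP[/negbTE xs _].
  by rewrite /B xs.
- move=> _; rewrite /m1 /= /pushforward /mrestr.
  by rewrite -ge0_fin_numE ?measure_ge0// fin_num_measure// preimage_setT setTI.
Qed.

(** Independence in the form used below: the weight of a path is a function of
    the environment at the sites that the path has left, and the events [rect
    s A] bear on sites not yet left. *)
Lemma integral_indep (s : seq (site D)) (A : site D -> set (transition R D))
    (F : environment R D -> \bar R) : uniq s ->
  (forall x, measurable (A x)) -> measurable_fun [set: environment R D] F ->
  (forall w, 0 <= F w)%E ->
  (forall w w', (forall x, x \notin s -> w x = w' x) -> F w = F w') ->
  (\int[Q]_(w in rect s A) F w = Q (rect s A) * \int[Q]_w F w)%E.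
Proof.
move=> us mA mF F0 Fdep.
have mrs : measurable (rect s A) by exact: measurable_rect.
have Qfin : (Q (rect s A)) \is a fin_num by exact: fin_num_measure.
have Qge : (0 <= fine (Q (rect s A)))%R by exact/fine_ge0/measure_ge0.
have mr := measurable_reset s.
have FE : F = F \o reset s.
  apply/funext => w /=; apply: Fdep => x xs; by rewrite /reset (negbTE xs).
pose m1 : {measure set _ -> \bar R} :=
  measure_function_pushforward__canonical__measure_function_Measure (mrestr Q
    mrs) mr.
pose p2 : {measure set _ -> \bar R} :=
  measure_function_pushforward__canonical__measure_function_Measure Q mr.
pose m2 : {measure set _ -> \bar R} := mscale (NngNum Qge) p2.
transitivity (\int[mrestr Q mrs]_(w in rect s A) F w)%E.
  apply: eq_measure_integral => B mB BA; by rewrite /= /mrestr setIidl.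
transitivity (\int[mrestr Q mrs]_w F w)%E.
  rewrite [RHS](@ge0_negligible_integral _ _ _ _ _ (~` rect s A))//.
  - by rewrite setTD setCK.
  - exact: measurableC.
  - by rewrite /= /mrestr setICl measure0.
transitivity (\int[m1]_w F w)%E.
  by rewrite ge0_integral_pushforward//= preimage_setT [in LHS]FE.
transitivity (\int[m2]_w F w)%E.
  apply: eq_measure_integral => B mB _.
  rewrite /m1 /m2 /= /mscale /= /pushforward /mrestr fineK//.
  exact: reset_indep.
rewrite ge0_integral_mscale//= fineK//; congr (_ * _)%E.
by rewrite ge0_integral_pushforward//= preimage_setT [in RHS]FE.
Qed.

End independence.

(** * The law of finitely many steps *)

Section walk.
Variables (R : realType) (D : nat).

(** The latest position comes first, so that one more step is one more [cons].
    *)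
Fixpoint hist (X : nat -> site D) (n : nat) : seq (site D) :=
  if n is m.+1 then X n :: hist X m else [:: X 0%N].

Lemma hist_eq (X Y : nat -> site D) n :
  (forall i, (i <= n)%N -> X i = Y i) -> hist X n = hist Y n.
Proof.
elim: n => [|n IH] h /=; first by rewrite h.
by rewrite h// IH// => i ni; apply: h; rewrite leqW.
Qed.

Lemma histE (X : nat -> site D) n : hist X n = X n :: behead (hist X n).
Proof. by case: n. Qed.

Lemma nth_hist (X : nat -> site D) n i : (i <= n)%N ->
  nth 0 (hist X n) i = X (n - i)%N.
Proof.
elim: n i => [|n IH] [|i]//= ni; first by rewrite IH.
Qed.

Lemma mem_hist (X : nat -> site D) n x :
  reflect (exists2 m, (m <= n)%N & x = X m) (x \in hist X n).
Proof.
apply: (iffP idP).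
  elim: n => [|n IH] /=; first by rewrite inE => /eqP ->; exists 0%N.
  rewrite inE => /orP[/eqP ->|/IH[m mn ->]]; first by exists n.+1.
  by exists m => //; rewrite leqW.
move=> [m mn ->]; elim: n mn => [|n IH]; first by rewrite leqn0 => /eqP ->;
  rewrite mem_head.
rewrite leq_eqVlt => /orP[/eqP ->|mn]; first by rewrite mem_head.
by rewrite /= inE IH ?orbT.
Qed.

Lemma measurable_coord1 n (x : site D) :
  measurable [set X : path_space D | X n = x].
Proof. by apply: sub_sigma_algebra; exists n, x. Qed.

(** Histories of a given length are countably many. *)
Lemma measurable_hist (P : set (seq (site D))) n :
  measurable [set X : path_space D | P (hist X n)].
Proof.
have m1 l : measurable [set X : path_space D | hist X n = l].
  elim: n l => [|n IH] [|x l].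
  - by rewrite (_ : [set X | _] = set0) //; apply/seteqP; split.
  - case: l => [|y l].
      rewrite (_ : [set X | _] = [set X : path_space D | X 0%N = x]).
        exact: measurable_coord1.
      by apply/seteqP; split=> X /= [->].
    by rewrite (_ : [set X | _] = set0) //; apply/seteqP; split.
  - by rewrite (_ : [set X | _] = set0) //; apply/seteqP; split.
  - rewrite (_ : [set X | _] = [set X : path_space D | X n.+1 = x] `&`
      [set X : path_space D | hist X n = l]).
      by apply: measurableI; [exact: measurable_coord1|exact: IH].
    apply/seteqP; split=> X /=; first by move=> [-> ->].
    by move=> [-> ->].
rewrite (_ : [set X | _] =
  \bigcup_(l in P) [set X : path_space D | hist X n = l]).
  exact: bigcup_measurable_countType.
apply/seteqP; split=> X /=; first by move=> h; exists (hist X n).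
by move=> [l Pl /= ->].
Qed.

Lemma measurable_coord (P : set (site D)) n :
  measurable [set X : path_space D | P (X n)].
Proof.
rewrite (_ : [set X | _] =
   [set X : path_space D | P (head 0 (hist X n))]).
  exact: (@measurable_hist [set l | P (head 0 l)]).
by apply/seteqP; split=> X /=; rewrite (histE X n).
Qed.

(** The mean of [G (X_n :: ... :: X_0 :: V)] for the walk in [w] started at
    [x]; [V] is the past before the start. Being a finite sum of products of
    transition probabilities, it can be integrated over the environment step
    by step. *)
Fixpoint expect (w : site D -> dir D -> R) (n : nat) (V : seq (site D))
    (x : site D) (G : seq (site D) -> R) : R :=
  if n is m.+1 then \sum_e w x e * expect w m (x :: V) (x + unitvec e) G
  else G (x :: V).

Lemma unitvecE (e : dir D) k :
  unitvec e 0 k = if k == e.1 then (if e.2 then 1 else -1) else 0.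
Proof.
case: e => i [] /=; rewrite /unitvec /= !mxE eqxx /=; first by case: eqP.
by case: eqP; rewrite ?oppr0.
Qed.

Lemma unitvec_inj : injective (@unitvec D).
Proof.
move=> [i b] [j c] h.
have := congr1 (fun v : site D => v 0 i) h; rewrite !unitvecE /= eqxx.
case: (eqVneq i j) => [->|_]; last by case: b {h}.
by case: b {h}; case: c.
Qed.

Section quenched_history.
Variables (w : environment R D) (P : probability (path_space D) R).
Hypothesis (ew : is_environment w) (qP : quenched_law w P).

Let cyl m (x : nat -> site D) :=
  [set X : path_space D | forall i, (i <= m)%N -> X i = x i].

Let mcyl m x : measurable (cyl m x).
Proof.
rewrite (_ : cyl m x = [set X : path_space D | hist X m = hist x m]).
  exact: (@measurable_hist [set l | l = hist x m]).
apply/seteqP; split=> X /=; first exact: hist_eq.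
move=> h i im.
have := congr1 (fun l => nth 0 l (m - i)) h.
by rewrite !nth_hist ?leq_subr// subKn.
Qed.

Let ext m (x : nat -> site D) e i :=
  if (i <= m)%N then x i else x m + unitvec e.

Lemma cyl_ext m x e : cyl m.+1 (ext m x e) =
  [set X | (forall i, (i <= m)%N -> X i = x i) /\ X m.+1 = x m + unitvec e].
Proof.
apply/seteqP; split=> X /=.
  move=> h; split=> [i im|]; first by rewrite h ?leqW// /ext im.
  by rewrite h// /ext ltnn.
move=> [h1 h2] i; rewrite leq_eqVlt => /orP[/eqP ->|]; first by rewrite /ext
  ltnn.
by rewrite ltnS => im; rewrite h1// /ext im.
Qed.

Lemma cyl_split m x E : measurable E ->
  P (cyl m x `&` E) = (\sum_(e : dir D) P (cyl m.+1 (ext m x e) `&` E))%E.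
Proof.
move=> mE.
pose U := \bigcup_(e in [set: dir D]) cyl m.+1 (ext m x e).
have tU : trivIset [set: dir D] (fun e => cyl m.+1 (ext m x e)).
  apply/trivIsetP => e e' _ _ /eqP ee'.
  apply/seteqP; split=> X //; rewrite !cyl_ext /= => -[[_ h] [_ h']].
  by apply: ee'; apply: unitvec_inj; apply: (addrI (x m)); rewrite -h -h'.
have mU : measurable U.
  by apply: fin_bigcup_measurable => // e _; exact: mcyl.
have PU F : measurable F -> P (U `&` F) = (\sum_(e : dir D) P (cyl m.+1 (ext m
  x e) `&` F))%E.
  move=> mF; rewrite setI_bigcupl measure_bigcup_finType//.
    by move=> e; apply: measurableI => //; exact: mcyl.
  exact: trivIset_setIr.
have UA : U `<=` cyl m x.
  by move=> X [e _]; rewrite cyl_ext /= => -[].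
have PUA : P U = P (cyl m x).
  rewrite -[U]setIT PU//.
  under eq_bigr do rewrite setIT cyl_ext (qP.2 m x).
  rewrite -ge0_sume_distrr; last by move=> e _; rewrite lee_fin (ew (x m)).1.
  by rewrite sumEFin (ew (x m)).2 mule1.
rewrite -PU//.
have nN : P (cyl m x `\` U) = 0%E.
  rewrite measureD//; last by rewrite -ge0_fin_numE// fin_num_measure.
  rewrite setIidr//; apply: etrans (congr1 (fun t => P (cyl m x) - t)%E PUA) _.
  by rewrite subee// fin_num_measure.
rewrite -[in LHS](setDUK UA) setIUl measureU.
- rewrite [X in (_ + X)%E](_ : _ = 0%E) ?adde0//.
  apply: (subset_measure0 _ _ _ nN); last exact: subIsetl.
    by apply: measurableI => //; apply: measurableD.
  exact: measurableD.
- exact: measurableI.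
- by apply: measurableI => //; apply: measurableD.
- by rewrite setIACA setDIK set0I.
Qed.

(** One more step splits a cylinder into its [2 D] extensions, up to a null
    set because the transition probabilities out of a site add up to 1. *)
Lemma quenched_hist_cylinder (G : seq (site D) -> bool) n m x :
  P (cyl m x `&` [set X | G (hist X (m + n))]) =
  (P (cyl m x) * (expect w n (behead (hist x m)) (x m) (fun l => (G
    l)%:R))%:E)%E.
Proof.
elim: n m x => [|n IH] m x /=.
  rewrite addn0 -histE; case: (boolP (G (hist x m))) => Gx.
    rewrite mule1 setIidl// => X /= /hist_eq ->; exact: Gx.
  rewrite mule0 [X in P X](_ : _ = set0) ?measure0//.
  apply/seteqP; split=> X //= [/hist_eq ->]; by rewrite (negbTE Gx).
rewrite cyl_split; last by exact: (@measurable_hist [set l | G l]).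
have Pfin y k : P (cyl k y) \is a fin_num by rewrite fin_num_measure.
rewrite -(fineK (Pfin x m)) -EFinM mulr_sumr -sumEFin.
apply: eq_bigr => e _.
rewrite addnS -addSn IH /= -histE.
have -> : hist (ext m x e) m = hist x m.
  by apply: hist_eq => i im; rewrite /ext im.
rewrite {2}/ext ltnn cyl_ext (qP.2 m x) -(fineK (Pfin x m)) !EFinM muleA.
by congr (_ * _ * _)%E.
Qed.

(** Transfers [expect] to the chain, whose start at [0] is almost sure. *)
Lemma quenched_hist (G : seq (site D) -> bool) n :
  P [set X | G (hist X n)] =
  (expect w n [::] 0 (fun l => (G l)%:R))%:E.
Proof.
have mG : measurable [set X : path_space D | G (hist X n)].
  exact: (@measurable_hist [set l | G l]).
have c0 : cyl 0 (fun=> 0) = [set X | X 0%N = 0].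
  apply/seteqP; split=> X /= h; first exact: h.
  by move=> i; rewrite leqn0 => /eqP ->.
have := quenched_hist_cylinder G n 0 (fun=> 0); rewrite add0n c0 qP.1 mul1e /=
  => <-.
have m0 : measurable [set X : path_space D | X 0%N = 0] by rewrite -c0.
have P0C : P (~` [set X : path_space D | X 0%N = 0]) = 0%E.
  by rewrite probability_setC// qP.1 subee.
rewrite (measureDI P mG m0) setDE.
rewrite [X in (X + _)%E](_ : _ = 0%E) ?add0e; first by rewrite setIC.
apply: (subset_measure0 _ _ _ P0C); last exact: subIsetr.
  by apply: measurableI => //; exact: measurableC.
exact: measurableC.
Qed.
End quenched_history.

End walk.

(** * Returns to the previous site, and the Green function *)

Section expect_theory.
Variables (R : realType) (D : nat) (w : environment R D).

(** The Markov property at time [n]; the definition of [expect] conditions on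
    the first step instead. *)
Lemma expect_last n V x G :
  expect w n.+1 V x G =
  expect w n V x (fun l => \sum_e w (head 0 l) e *
                             G ((head 0 l + unitvec e) :: l)).
Proof.
elim: n V x => [//|n IH] V x.
by apply: eq_bigr => e _; congr (_ * _); exact: IH.
Qed.

Lemma expect_lin n V x G H (a b : R) :
  expect w n V x (fun l => a * G l + b * H l) =
  a * expect w n V x G + b * expect w n V x H.
Proof.
elim: n V x => [|n IH] V x /=; first by [].
rewrite !mulr_sumr -big_split; apply: eq_bigr => e _ /=.
by rewrite IH; ring.
Qed.

Lemma expectZ n V x G (a : R) :
  expect w n V x (fun l => a * G l) = a * expect w n V x G.
Proof.
elim: n V x => [|n IH] V x /=; first by [].
by rewrite mulr_sumr; apply: eq_bigr => e _; rewrite IH mulrCA.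
Qed.

Lemma eq_expect n V x G H : G =1 H -> expect w n V x G = expect w n V x H.
Proof.
move=> GH; elim: n V x => [|n IH] V x /=; first exact: GH.
by apply: eq_bigr => e _; rewrite IH.
Qed.

Hypothesis ew : is_environment w.

Lemma expect_le n V x G H : (forall l, G l <= H l) ->
  expect w n V x G <= expect w n V x H.
Proof.
move=> GH; elim: n V x => [|n IH] V x /=; first exact: GH.
by apply: ler_sum => e _; rewrite ler_wpM2l// (ew x).1.
Qed.

Lemma expect_cst n V x (c : R) : expect w n V x (fun=> c) = c.
Proof.
elim: n V x => [|n IH] V x /=; first by [].
by under eq_bigr do rewrite IH; rewrite -mulr_suml (ew x).2 mul1r.
Qed.

Lemma expect_ge0 n V x G : (forall l, 0 <= G l) -> 0 <= expect w n V x G.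
Proof. by move=> G0; rewrite -(expect_cst n V x 0) expect_le. Qed.

(** The last [k] moves of the history each return to the site visited two
    steps before, which is how a walk behaves that stays on two sites. *)
Fixpoint alternates (k : nat) (l : seq (site D)) : bool :=
  if k is k'.+1 then
    if l is a :: ((b :: c :: _) as l') then (a == c) && alternates k' l' else
      false
  else true.

(** A return to the previous site uses one given direction. *)
Lemma alternates_bound n k : (forall x e, w x e <= 2^-1) ->
  expect w (n + k) [::] 0 (fun l => (alternates k l)%:R) <= 2^-1 ^+ k.
Proof.
move=> w2; elim: k => [|k IH].
  by rewrite addn0 expr0 /= expect_cst.
rewrite addnS expect_last exprS.
apply: le_trans (ler_wpM2l _ IH) => //.
rewrite -expectZ; apply: expect_le => l.
case: l => [|b [|c l]].
- by under eq_bigr do rewrite mulr0; rewrite big1//.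
- by under eq_bigr do rewrite mulr0; rewrite big1//.
rewrite [head _ _]/=.
under eq_bigr => e _ do rewrite [alternates k.+1 _]/= -mulnb natrM mulrA.
rewrite -mulr_suml ler_wpM2r//.
have [e0 /eqP e0P|ne] := pickP (fun e => b + unitvec e == c).
  rewrite (bigD1 e0)//= e0P eqxx mulr1 big1 ?addr0// => e ee0.
  rewrite (negbTE (_ : b + unitvec e != c)) ?mulr0//.
  apply: contraNneq ee0 => h; apply/eqP/(@unitvec_inj D)/(addrI b).
  by rewrite h e0P.
by rewrite big1// => e _; rewrite ne mulr0.
Qed.

End expect_theory.

Section green.
Variables (R : realType) (d : nat) (w : environment R d.+1).
Hypothesis ew : is_environment w.
Notation up := ((ord_max, true) : dir d.+1).
Notation dn := ((ord_max, false) : dir d.+1).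
Hypothesis w_up : forall x, w x up = 2 * w x dn.

Definition height (x : site d.+1) : int := x 0 ord_max.
Definition potential (x : site d.+1) : R := (4 / 3) ^ (- height x).

Lemma potential_gt0 x : 0 < potential x.
Proof. by apply: exprz_gt0; lra. Qed.

Lemma potential_le x (k : int) : height x <= k -> (4 / 3) ^ (- k) <= potential
  x.
Proof.
by move=> hk; apply: ler_weXz2l; [lra|rewrite lerN2].
Qed.

(** If [u] is the probability of going down, the mean of the potential is
    multiplied by 1 - 3u + 2u (3/4) + u (4/3) = 1 - u/6. *)
Lemma drift x : \sum_e w x e * potential (x + unitvec e) =
  1 * potential x + (- 6^-1) * (potential x * w x dn).
Proof.
have potentialE e : potential (x + unitvec e) = potential x *
   (if ord_max == e.1 then (if e.2 then 3 / 4 else 4 / 3) else 1).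
  rewrite /potential /height mxE unitvecE opprD expfzDr; last by apply/eqP; lra.
  congr (_ * _); case: eqP => //; case: e.2 => //.
  by move=> _; rewrite exprN1; field.
under eq_bigr => e _ do rewrite potentialE.
have := (ew x).2.
have du : dn != up by rewrite xpair_eqE andbF.
rewrite (bigD1 up)// (bigD1 dn)//= => h.
rewrite (bigD1 up)// (bigD1 dn)//= eqxx.
rewrite [X in _ + (_ + X) = _](_ : _ = (\sum_(i | (i != up) && (i != dn)) w x
  i) * potential x); last first.
  rewrite mulr_suml; apply: eq_bigr => -[i b] /= /andP[h1 h2].
  case: eqP => [E|]; last by rewrite mulr1.
  by move: h1 h2; rewrite -E; case: b => /=; rewrite ?eqxx.
move: h; rewrite w_up; set S := \sum_(i | _) _; move=> h.
have -> : S = 1 - 3 * w x dn by lra.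
by field.
Qed.

(** By [drift] each term is six times the decrease of the mean potential
    during one step; the sum telescopes and the potential, positive, starts
    from 1. *)
Lemma green_bound N :
  \sum_(n < N) expect w n [::] 0
    (fun l => potential (head 0 l) * w (head 0 l) dn) <= 6.
Proof.
pose E n := expect w n [::] 0 (fun l => potential (head 0 l)).
have step n : expect w n [::] 0 (fun l => potential (head 0 l) * w (head 0 l)
  dn) =
    6 * (E n - E n.+1).
  have -> : E n.+1 = 1 * E n + (- 6^-1) * expect w n [::] 0 (fun l => potential
    (head 0 l) * w (head 0 l) dn).
    rewrite /E -expect_lin expect_last; apply: eq_expect => l /=.
    by rewrite drift.
  by field.
have sumE : \sum_(n < N) expect w n [::] 0
    (fun l => potential (head 0 l) * w (head 0 l) dn) = 6 * (E 0%N - E N).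
  elim: N => [|N IH]; first by rewrite big_ord0 subrr mulr0.
  by rewrite big_ord_recr /= IH step; ring.
rewrite sumE.
have : 0 <= E N by apply: expect_ge0 => // l; exact/ltW/potential_gt0.
have -> : E 0%N = 1 by rewrite /E /= /potential /height mxE expr0z.
by move=> ?; lra.
Qed.
End green.

(** * Discounted hitting times, and the delay due to traps *)

Section hitting.
Variables (R : realType) (D : nat) (w : environment R D).
Implicit Types (B : site D -> bool) (f g : site D -> R).

(** The mean of z^tau f(X_tau) on the event tau <= n, for tau the hitting time
    of [B]. The discount [z] makes the time lost before tau a multiplicative
    loss, so that successive delays multiply. *)
Fixpoint hit (z : R) (n : nat) B f (x : site D) : R :=
  if B x then f x
  else if n is m.+1 then z * \sum_e w x e * hit z m B f (x + unitvec e) else 0.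

Lemma hit_in z n B f x : B x -> hit z n B f x = f x.
Proof. by case: n => [|n] /= ->. Qed.

Lemma hit_lin z n B f (M : nat) (c : nat -> R) (t : nat -> site D -> R) x :
  hit z n B (fun y => f y - \sum_(j < M) c j * t j y) x =
  hit z n B f x - \sum_(j < M) c j * hit z n B (t j) x.
Proof.
elim: n x => [|n IH] x /=.
  case: ifP => // _; rewrite big1 ?subr0// => j _; exact: mulr0.
case: ifP => // _.
under eq_bigr do rewrite IH mulrBr.
rewrite sumrB mulrBr; congr (_ - _).
rewrite [X in z * X](eq_bigr _ (fun e _ => mulr_sumr _ _ _ _)).
rewrite [X in z * X]exchange_big mulr_sumr; apply: eq_bigr => j _ /=.
by rewrite !mulr_sumr; apply: eq_bigr => e _; ring.
Qed.

Hypothesis ew : is_environment w.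
Variable z : R.
Hypothesis z01 : 0 <= z <= 1.

Let z0 : 0 <= z. Proof. by case/andP: z01. Qed.
Let z1 : z <= 1. Proof. by case/andP: z01. Qed.

Lemma hit_ge0 n B f x : (forall y, 0 <= f y) -> 0 <= hit z n B f x.
Proof.
move=> f0; elim: n x => [|n IH] x /=; case: ifP => // _.
by apply: mulr_ge0 => //; apply: sumr_ge0 => e _; rewrite mulr_ge0// (ew x).1.
Qed.

Lemma hit_le1 n B f x : (forall y, f y <= 1) -> hit z n B f x <= 1.
Proof.
move=> f1; elim: n x => [|n IH] x /=; case: ifP => // _.
apply: (@le_trans _ _ (z * 1)); last by rewrite mulr1.
rewrite ler_wpM2l// -(ew x).2; apply: ler_sum => e _.
by rewrite -[leRHS]mulr1 ler_wpM2l// (ew x).1.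
Qed.

(** On the event tau <= n the discount z^tau is at least z^n. *)
Lemma expect_hit n B V x : ~~ has B V ->
  z ^+ n * expect w n V x (fun l => (has B l)%:R) <= hit z n B (fun=> 1) x.
Proof.
elim: n V x => [|n IH] V x nV.
  by rewrite mul1r /= (negbTE nV) orbF; case: (B x).
have [Bx|nBx] := boolP (B x).
  rewrite (hit_in _ _ _ Bx) -[leRHS]mulr1; apply: ler_pM.
  - exact: exprn_ge0.
  - by apply: expect_ge0.
  - exact: exprn_ile1.
  rewrite -[leRHS](expect_cst ew n.+1 V x 1); apply: expect_le => // l.
  by rewrite lern1; case: has.
rewrite /= (negbTE nBx) exprS -mulrA ler_wpM2l// mulr_sumr ler_sum// => e _.
rewrite mulrCA ler_wpM2l ?(ew x).1//; apply: IH.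
by rewrite /= (negbTE nBx).
Qed.

Variable L : site D -> int.
Hypothesis L_step : forall x e, L (x + unitvec e) <= L x + 1.
Definition above (k : int) (x : site D) := k <= L x.

(** The strong Markov property at the first passage of level [k]. As [L] grows
    by at most 1 per step, this passage occurs at a site where [L] is exactly
    [k]. *)
Lemma hit_markov k n g x :
  (forall m y, L y = k -> hit z m (above (k + 1)) (fun=> 1) y <= g y) ->
  L x <= k -> hit z n (above (k + 1)) (fun=> 1) x <= hit z n (above k) g x.
Proof.
move=> Hg; elim: n x => [|n IH] x Lx.
  have n1 : above (k + 1) x = false.
    by rewrite /above; apply/negbTE; rewrite -ltNge; lia.
  rewrite /= n1; case: ifP => // kL.
  have := Hg 0%N x; rewrite /= n1; apply.
  by apply/eqP; rewrite eq_le Lx.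
have [kL|kL] := leP k (L x).
  rewrite [leRHS](hit_in _ _ _)//; apply: Hg.
  by apply/eqP; rewrite eq_le Lx.
have n1 : above (k + 1) x = false by rewrite /above; apply/negbTE; rewrite
  -ltNge; lia.
have n2 : above k x = false by rewrite /above; apply/negbTE; rewrite -ltNge.
rewrite /= n1 n2 ler_wpM2l// ler_sum// => e _.
rewrite ler_wpM2l ?(ew x).1//; apply: IH.
by have := L_step x e; lia.
Qed.

End hitting.

Section trap.
Variables (R : realType) (d : nat).

Definition odd_coord (x : site d.+1) (i : 'I_d.+1) : bool := (x 0%R i %% 2)%Z
  == 1.
(** The horizontal directions that do not leave the block: increase an even
    coordinate, decrease an odd one. *)
Definition inward (x : site d.+1) (e : dir d.+1) : bool :=
  (e.1 != ord_max) && (e.2 != odd_coord x e.1).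

(** The default branch of [insub] is the last coordinate, which blocks leave
    fixed. *)
Definition block_site (y : site d.+1) (v : {ffun 'I_d -> bool}) : site d.+1 :=
  \row_k (if insub (val k) is Some i then 2 * (y 0%R k %/ 2)%Z + (v i : nat)%:Z
          else y 0 k).
Definition block (y : site d.+1) : seq (site d.+1) :=
  [seq block_site y v | v <- enum {ffun 'I_d -> bool}].

Lemma block_site_inj y : injective (block_site y).
Proof.
move=> v v' h; apply/ffunP => i.
have := congr1 (fun x : site d.+1 => x 0 (widen_ord (leqnSn d) i)) h.
rewrite !mxE /=; case: insubP => [j _ ji|]; last by rewrite ltn_ord.
have -> : j = i by apply: val_inj.
by case: (v i); case: (v' i) => //=; lia.
Qed.

Lemma block_uniq y : uniq (block y).
Proof. by rewrite map_inj_uniq ?enum_uniq//; exact: block_site_inj. Qed.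

Lemma size_block y : size (block y) = (2 ^ d)%N.
Proof. by rewrite size_map -cardE card_ffun card_bool card_ord. Qed.

Lemma block_half (y x : site d.+1) i : x \in block y -> (x 0%R i %/ 2)%Z = (y
  0%R i %/ 2)%Z.
Proof.
case/mapP => v _ ->; rewrite mxE; case: insubP => // j _ _.
by case: (v j) => /=; lia.
Qed.

Lemma mem_block (y x : site d.+1) : (forall i, (x 0%R i %/ 2)%Z = (y 0%R i %/
  2)%Z) ->
  x 0 ord_max = y 0 ord_max -> x \in block y.
Proof.
move=> xy h; apply/mapP; exists [ffun i => odd_coord x (widen_ord (leqnSn d)
  i)].
  by rewrite mem_enum.
apply/rowP => k; rewrite mxE; case: insubP => [j jk e|].
  rewrite ffunE (_ : widen_ord _ j = k); last exact: val_inj.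
  by rewrite /odd_coord -xy; case: eqP => /= ?; lia.
rewrite -leqNgt => dk; suff -> : k = ord_max by [].
by apply: val_inj => /=; apply/eqP; rewrite eqn_leq dk -ltnS ltn_ord.
Qed.

Lemma block_step y x e : x \in block y -> inward x e ->
  x + unitvec e \in block y.
Proof.
move=> xy /andP[em ep]; have hm : x 0 ord_max = y 0 ord_max.
  case/mapP: xy => v _ ->; rewrite mxE; case: insubP => // j jd _.
  by rewrite ltnn in jd.
apply: mem_block => [i|]; last by rewrite mxE unitvecE eq_sym (negbTE em) addr0.
rewrite -(block_half i xy) mxE unitvecE; case: eqP => [->|_]; last by rewrite
  addr0.
move: ep; rewrite /odd_coord; case: e.2; case: eqP => //= ? _; lia.
Qed.

Variables (w : environment R d.+1).
Hypothesis ew : is_environment w.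

Definition trapping (a : R) (x : site d.+1) (t : transition R d.+1) : bool :=
  1 - a <= \sum_(e | inward x e) t e.

Variable z : R.
Hypothesis z01 : 0 <= z <= 1.
Variable L : site d.+1 -> int.
Hypothesis L_block : forall y x, x \in block y -> L x = L y.

(** With probability at least (1 - a)^j the walk makes its first [j] steps
    inside the block, which costs a factor of at most z^j; otherwise the
    discount is at most 1. *)
Lemma hit_trap (a : R) (y x : site d.+1) n j : 0 <= a <= 1 ->
  (forall x, x \in block y -> trapping a x (w x)) -> x \in block y ->
  hit w z n (above L (L y + 1)) (fun=> 1) x <= 1 - (1 - a) ^+ j * (1 - z ^+ j).
Proof.
move=> /andP[a0 a1] tr; case/andP: (z01) => z0 z1.
elim: j n x => [|j IH] n x xy.
  rewrite !expr0 subrr mulr0 subr0. by apply: (hit_le1 ew z01).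
set dl := (1 - a) ^+ j * (1 - z ^+ j).
have zj : 0 <= 1 - z ^+ j by rewrite subr_ge0 exprn_ile1.
have aj : 0 <= (1 - a) ^+ j <= 1 by rewrite exprn_ge0 ?exprn_ile1; lra.
have aj1 : 0 <= (1 - a) ^+ j.+1 <= 1 by rewrite exprn_ge0 ?exprn_ile1; lra.
have zj1 : 0 <= z ^+ j.+1 <= 1 by rewrite exprn_ge0 ?exprn_ile1//; lra.
have nx : above L (L y + 1) x = false.
  by rewrite /above (L_block xy); apply/negbTE; rewrite -ltNge ltrDl.
case: n => [|n]; rewrite /= nx.
  by nra.
apply: (@le_trans _ _ (z * (1 - (1 - a) * dl))).
  rewrite ler_wpM2l//.
  apply: (@le_trans _ _ (\sum_e (w x e - (inward x e)%:R * w x e * dl))).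
    apply: ler_sum => e _; have we := (ew x).1 e.
    have [ie|_] := boolP (inward x e); last first.
      by rewrite mul0r mul0r subr0 -[leRHS]mulr1 ler_wpM2l// (hit_le1 ew z01).
    rewrite mul1r -{2}[w x e]mulr1 -mulrBr ler_wpM2l// IH//.
    exact: block_step.
  rewrite sumrB (ew x).2 -mulr_suml lerB// ler_wpM2r//.
    by rewrite /dl mulr_ge0; lra.
  apply: le_trans (tr _ xy) _; rewrite big_mkcond /= ler_sum// => e _.
  by case: ifP; rewrite ?mul1r ?mul0r.
rewrite /dl mulrA -exprS; rewrite exprS in zj1 *; nra.
Qed.

(** The conditions are nested in [j], so the loss comes from the largest [m =
    j.+1] for which the block is a trap: by Bernoulli's inequality (1 -
    1/(2m))^m >= 1/2 and [hit_trap] gives the loss (1 - z^m)/2. Writing it as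
    a telescopic sum makes it linear in the indicators of the trapping events,
    as needed to average it. *)
Lemma hit_block (y : site d.+1) n M :
  hit w z n (above L (L y + 1)) (fun=> 1) y <=
  1 - \sum_(j < M) 2^-1 * (z ^+ j - z ^+ j.+1) *
     (all (fun x => trapping (2 * j.+1%:R)^-1 x (w x)) (block y))%:R.
Proof.
case/andP: (z01) => z0 z1.
have yy : y \in block y by exact: mem_block.
elim: M => [|M IH]; first by rewrite big_ord0 subr0 (hit_le1 ew z01).
rewrite big_ord_recr /=.
case: allP => [tM|_]; last by rewrite mulr0 addr0.
have a01 (j : nat) : 0 <= (2 * j.+1%:R : R)^-1 <= 1.
  rewrite invr_ge0 mulr_ge0//= invf_le1 ?mulr_gt0 ?ltr0n//.
  by rewrite -natrM ler1n.
have tj (j : nat) : (j <= M)%N ->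
    all (fun x => trapping (2 * j.+1%:R)^-1 x (w x)) (block y).
  move=> jM; apply/allP => x /tM; apply: le_trans; rewrite lerB// .
  by rewrite lef_pV2 ?posrE ?mulr_gt0// ler_wpM2l// ler_nat.
have -> : \sum_(j < M) 2^-1 * (z ^+ j - z ^+ j.+1) *
     (all (fun x => trapping (2 * j.+1%:R)^-1 x (w x)) (block y))%:R =
     2^-1 * (1 - z ^+ M).
  under eq_bigr => j _ do rewrite (tj j (ltnW (ltn_ord j))) mulr1.
  rewrite -mulr_sumr; congr (_ * _).
  elim: {IH tM tj} M => [|M IH]; first by rewrite big_ord0 expr0 subrr.
  by rewrite big_ord_recr /= IH; ring.
have := @hit_trap _ y y n M.+1 (a01 M) tM yy.
have bern : 2^-1 <= (1 - (2 * M.+1%:R)^-1) ^+ M.+1 :> R.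
  apply: le_trans (bernoulli_ineq M.+1 (a01 M)).
  have : M.+1%:R != 0 :> R by rewrite pnatr_eq0.
  by move=> M0; rewrite invfM mulrCA mulfV// mulr1; lra.
have : z ^+ M.+1 <= 1 by rewrite exprn_ile1.
move: bern; set b := (1 - _) ^+ M.+1; set zM := z ^+ M.+1 => bern zM1 hu.
apply: le_trans hu _; rewrite mulr1.
have : 0 <= (b - 2^-1) * (1 - zM) by rewrite mulr_ge0 ?subr_ge0.
by lra.
Qed.
End trap.

(** * Almost sure properties of the transitions *)

Section good_transitions.
Variables (R : realType) (d : nat).
Notation up := ((ord_max, true) : dir d.+1).
Notation dn := ((ord_max, false) : dir d.+1).

(** What the quenched estimates use of the model: these properties hold almost
    surely by [ex_marginal_good]. The bound [1 / d] is for the stay on two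
    sites. *)
Definition good : set (transition R d.+1) :=
  [set t | [/\ forall e, 0 <= t e, \sum_e t e = 1, t up = 2 * t dn,
               0 < t dn & forall e, t e <= d%:R^-1]].

Lemma measurable_good : measurable good.
Proof.
have mp e : measurable_fun setT (fun t : transition R d.+1 => t e).
  exact: measurable_proj.
have mc (c : R) : measurable_fun [set: transition R d.+1] (fun=> c).
  exact: measurable_cst.
have ms : measurable_fun setT (fun t : transition R d.+1 => \sum_e t e).
  exact: measurable_sum.
have m2 : measurable_fun setT (fun t : transition R d.+1 => 2 * t dn).
  exact: measurable_funM.
rewrite (_ : good =
  (\bigcap_(e in [set: dir d.+1]) [set t : transition R d.+1 | 0 <= t e]) `&`
  ([set t | \sum_e t e <= 1] `&` [set t | 1 <= \sum_e t e]) `&`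
  ([set t | t up <= 2 * t dn] `&` [set t | 2 * t dn <= t up]) `&`
  ~` [set t | t dn <= 0] `&`
  (\bigcap_(e in [set: dir d.+1]) [set t : transition R d.+1 | t e <=
    d%:R^-1])); last first.
  apply/seteqP; split=> t /=.
    move=> [h1 h2 h3 h4 h5]; rewrite h2 h3 !lexx; do !split => //.
    - by move=> e _; exact: h1.
    - by rewrite leNgt h4.
    - by move=> e _; exact: h5.
  move=> [[[[h1 [h2 h2']] [h3 h3']] h4] h5]; split=> //.
  - by move=> e; exact: h1.
  - by apply/eqP; rewrite eq_le h2.
  - by apply/eqP; rewrite eq_le h3.
  - by rewrite ltNge; apply/negP.
  - by move=> e; exact: h5.
apply: measurableI; last first.
  by apply: fin_bigcap_measurable => // e _; exact: measurable_le_set.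
apply: measurableI; last by apply: measurableC; exact: measurable_le_set.
apply: measurableI; last by apply: measurableI; exact: measurable_le_set.
apply: measurableI; last by apply: measurableI; exact: measurable_le_set.
by apply: fin_bigcap_measurable => // e _; exact: measurable_le_set.
Qed.

Variable t0 : transition R d.+1.
Hypothesis good_t0 : good t0.

(** Environments are good at all sites almost surely, but not surely.
    Replacing every other transition by a fixed good one makes all quenched
    quantities nonnegative and bounded for every environment. As this is done
    site by site, it does not change which sites a function involves. *)
Definition clean (t : transition R d.+1) : transition R d.+1 :=
  if `[< good t >] then t else t0.
Definition clean_env (w : environment R d.+1) : environment R d.+1 :=
  fun x => clean (w x).

Lemma clean_good t : good (clean t).
Proof. by rewrite /clean; case: asboolP. Qed.

Lemma clean_id t : good t -> clean t = t.
Proof. by rewrite /clean; case: asboolP. Qed.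

Lemma measurable_clean : measurable_fun setT clean.
Proof.
move=> _ B mB; rewrite setTI.
rewrite (_ : clean @^-1` B = (good `&` B) `|` (~` good `&` [set _ | B t0])).
  apply: measurableU; first exact: measurableI measurable_good mB.
  apply: measurableI; first exact: measurableC measurable_good.
  have [Bt|Bt] := pselect (B t0).
    by rewrite (_ : [set _ | _] = setT) //; apply/seteqP; split.
  by rewrite (_ : [set _ | _] = set0) //; apply/seteqP; split.
apply/seteqP; split=> t; rewrite /preimage /clean /=.
  by case: asboolP => h Bt; [left|right].
by case: asboolP => h [[]|[]].
Qed.

Lemma clean_environment w : is_environment (clean_env w).
Proof. by move=> x; have [] := clean_good (w x). Qed.

Lemma clean_env_id w : (forall x, good (w x)) -> clean_env w = w.
Proof. by move=> gw; apply/funext => x; exact: clean_id. Qed.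

Lemma measurable_clean_coord e :
  measurable_fun setT (fun t : transition R d.+1 => clean t e).
Proof.
have -> : (fun t : transition R d.+1 => clean t e) =
  (fun t : transition R d.+1 => t e) \o clean by [].
by apply: measurableT_comp; [exact: measurable_proj|exact: measurable_clean].
Qed.

Lemma measurable_clean_env x e : measurable_fun setT
  (fun w : environment R d.+1 => clean_env w x e).
Proof.
have -> : (fun w : environment R d.+1 => clean_env w x e) =
  (fun t : transition R d.+1 => clean t e) \o (fun w : environment R d.+1 => w
    x)
  by [].
by apply: measurableT_comp; [exact: measurable_clean_coord|exact:
  measurable_proj].
Qed.

Lemma measurable_expect n V x (G : environment R d.+1 -> seq (site d.+1) -> R) :
  (forall l, measurable_fun setT (fun w => G w l)) ->
  measurable_fun setT (fun w => expect (clean_env w) n V x (G w)).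
Proof.
move=> mG; elim: n V x => [|n IH] V x //=.
apply: measurable_sum => e; apply: measurable_funM; last exact: IH.
exact: measurable_clean_env.
Qed.

Lemma measurable_hit z n B (f : environment R d.+1 -> site d.+1 -> R) x :
  (forall y, measurable_fun setT (fun w => f w y)) ->
  measurable_fun setT (fun w => hit (clean_env w) z n B (f w) x).
Proof.
move=> mf; elim: n x => [|n IH] x /=; case: (B x) => //.
apply: measurable_funM => //; apply: measurable_sum => e.
apply: measurable_funM; last exact: IH.
exact: measurable_clean_env.
Qed.

End good_transitions.

(** * The annealed law *)

Section annealed_measure.
Variables (R : realType) (D : nat) (Q : probability (environment R D) R).
Variable K : R.-pker (environment R D) ~> (path_space D).

Lemma annealed0 : annealed Q K set0 = 0%E.
Proof.
rewrite /annealed; under eq_integral do rewrite measure0.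
by rewrite integral0.
Qed.

Lemma annealed_ge0 A : (0 <= annealed Q K A)%E.
Proof. by apply: integral_ge0 => w _; exact: measure_ge0. Qed.

Lemma annealed_semi_sigma_additive : semi_sigma_additive (annealed Q K).
Proof.
move=> F mF tF mUF; rewrite /annealed.
rewrite [X in _ --> X](_ : _ = (\sum_(n <oo) \int[Q]_w K w (F n))%E).
  by apply: is_cvg_nneseries => n _ _; exact: annealed_ge0.
rewrite -integral_nneseries//; last by move=> n; exact: measurable_kernel.
apply: eq_integral => w _; rewrite measure_bigcup//.
by apply: eq_eseriesl => n; rewrite in_setT.
Qed.

HB.instance Definition _ := isMeasure.Build _ _ _ (annealed Q K)
  annealed0 annealed_ge0 annealed_semi_sigma_additive.

(** As the annealed law is a measure, the Borel-Cantelli lemma applies to it.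
    *)
Definition annealedm : {measure set (path_space D) -> \bar R} := annealed Q K.

Lemma annealedmT : annealedm setT = 1%E.
Proof.
rewrite /annealedm /= /annealed; under eq_integral do rewrite prob_kernel.
rewrite integral_cst// mul1e; exact: probability_setT.
Qed.

Lemma annealed_eq1 A N : measurable A -> measurable N ->
  ~` A `<=` N -> annealed Q K N = 0%E -> annealed Q K A = 1%E.
Proof.
move=> mA mN AN N0.
have AC0 : annealedm (~` A) = 0%E.
  by apply: (subset_measure0 _ mN AN N0); exact: measurableC.
rewrite -annealedmT -(setUv A) (measureU annealedm mA (measurableC mA) (setICr
  A)).
by rewrite [X in (_ + X)%E](AC0 : _ = _) adde0.
Qed.

End annealed_measure.

Section kernel_probability.
Variables (disp disp' : measure_display) (X : measurableType disp).
Variables (Y : measurableType disp') (R : realType) (K : R.-pker X ~> Y) (x :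
  X).

(** The values of a probability kernel come as measures; this makes a
    probability of each. *)
Definition kernel_law : set Y -> \bar R := K x.

HB.instance Definition _ := isMeasure.Build _ _ _ kernel_law
  (measure0 (K x)) (measure_ge0 (K x))
  (@measure_semi_sigma_additive _ _ _ (K x)).

HB.instance Definition _ :=
  Measure_isProbability.Build _ _ _ kernel_law (prob_kernel x).

Definition kernel_prob : probability Y R := kernel_law.

End kernel_probability.

Section annealed_good.
Variables (R : realType) (d : nat) (Q : probability (environment R d.+1) R).
Variable K : R.-pker (environment R d.+1) ~> (path_space d.+1).
Variable mu : set (transition R d.+1) -> \bar R.
Hypothesis iidQ : iid_environment mu Q.
Hypothesis qK : quenched_kernel K.
Hypothesis mu_good : mu (@good R d) = 1%E.

Lemma iid_marginal x A : measurable A -> Q [set w | A (w x)] = mu A.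
Proof.
move=> mA; have := @iidQ [:: x] (fun=> A) isT (fun=> mA).
rewrite big_seq1 => <-; congr (Q _); apply/seteqP; split=> w /=.
  by move=> Aw y; rewrite inE => /eqP ->.
by apply; rewrite mem_head.
Qed.

Lemma ae_good : {ae Q, forall w, forall x, good (w x)}.
Proof.
have m1 x : measurable [set w : environment R d.+1 | good (w x)].
  rewrite -[X in measurable X]setTI.
  exact: (@measurable_proj _ _ _ x) measurableT _ (@measurable_good R d).
apply: (@negligibleS _ _ _ _
    (\bigcup_x [set w : environment R d.+1 | ~ good (w x)])).
  by move=> w /existsNP[x nx]; exists x.
apply: negligible_bigcup_countType => x; apply/negligibleP.
  exact: measurableC (m1 x).
have := probability_setC Q (m1 x); rewrite (iid_marginal x)//; last exact:
  measurable_good.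
by rewrite mu_good subee.
Qed.

Variable t0 : transition R d.+1.
Hypothesis good_t0 : good t0.

(** Almost every environment is good at every site, hence fixed by [clean_env],
    and then the quenched formula applies. *)
Lemma annealed_hist (G : seq (site d.+1) -> bool) n :
  annealed Q K [set X | G (hist X n)] =
  (\int[Q]_w (expect (clean_env t0 w) n [::] 0 (fun l => (G l)%:R))%:E)%E.
Proof.
have mG : measurable [set X : path_space d.+1 | G (hist X n)].
  exact: (@measurable_hist _ [set l | G l]).
apply: ge0_ae_eq_integral => //.
- exact: measurable_kernel.
- apply/measurable_EFinP; apply: measurable_expect => l.
  exact: measurable_cst.
- move=> w _; rewrite lee_fin; apply: expect_ge0 => //.
  exact: clean_environment.
apply: (negligibleS _ ae_good) => w /= nh gw; apply: nh => _.
rewrite (clean_env_id _ gw); apply: (@quenched_hist _ _ _ (kernel_prob K w));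
  first by move=> x; have [] := gw x.
by apply: qK => x; have [] := gw x.
Qed.

Lemma annealed_quenched_null A : measurable A ->
  (forall w, is_environment w -> (forall x, good (w x)) -> K w A = 0%E) ->
  annealed Q K A = 0%E.
Proof.
move=> mA h; rewrite /annealed (ae_eq_integral (cst 0%E)) ?integral0//.
  exact: measurable_kernel.
apply: (negligibleS _ ae_good) => w /= nh gw; apply: nh => _; apply: h => // x.
by have [] := gw x.
Qed.
End annealed_good.

(** * Transience *)

Section transience.
Variables (R : realType) (d : nat) (Q : probability (environment R d.+1) R).
Variable K : R.-pker (environment R d.+1) ~> (path_space d.+1).
Variable mu : set (transition R d.+1) -> \bar R.
Hypothesis iidQ : iid_environment mu Q.
Hypothesis qK : quenched_kernel K.
Hypothesis mu_good : mu (@good R d) = 1%E.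
Variable t0 : transition R d.+1.
Hypothesis good_t0 : good t0.
Notation dn := ((ord_max, false) : dir d.+1).
Local Notation env := (environment R d.+1).
Local Notation cleanw w := (clean_env t0 w).

Lemma measurable_site_event x (A : set (transition R d.+1)) :
  measurable A -> measurable [set w : env | A (w x)].
Proof.
move=> mA; rewrite -[X in measurable X]setTI.
exact: (@measurable_proj _ _ _ x) measurableT _ mA.
Qed.

Lemma measurable_site_indic x (A : set (transition R d.+1)) : measurable A ->
  measurable_fun setT (fun w : env => (`[< A (w x) >])%:R : R).
Proof.
move=> mA; rewrite (_ : (fun w => _) = \1_[set w : env | A (w x)]).
  by apply/measurable_indicP; exact: measurable_site_event.
by apply/funext => w; rewrite indicE; congr (_%:R); apply/asboolP; rewrite ?inE.
Qed.

Definition depends_only_on (V : set (site d.+1)) (F : env -> R) :=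
  forall w w', (forall y, V y -> w y = w' y) -> F w = F w'.

Lemma integral_indep_indic (s : seq (site d.+1)) A (F : env -> R) : uniq s ->
  (forall x, measurable (A x)) -> measurable_fun setT F -> (forall w, 0 <= F w)
    ->
  depends_only_on [set y | y \notin s] F ->
  (\int[Q]_w (F w * (`[< rect s A w >])%:R)%:E =
   Q (rect s A) * \int[Q]_w (F w)%:E)%E.
Proof.
move=> us mA mF F0 dF.
rewrite -(integral_indep iidQ us mA).
- rewrite [RHS]integral_mkcond; apply: eq_integral => w _.
  rewrite patchE; case: asboolP => h; first by rewrite mem_set// mulr1.
  by rewrite memNset// mulr0.
- exact/measurable_EFinP.
- by move=> w; rewrite lee_fin.
- by move=> w w' ww'; congr EFin; apply: dF.
Qed.

(** The first step, under the integral over the environment. The factor [F]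
    stands for the weight of the steps already made. *)
Lemma integral_expect_step n V x (F : env -> R)
    (G : env -> seq (site d.+1) -> R) :
  measurable_fun setT F -> (forall w, 0 <= F w) ->
  (forall l, measurable_fun setT (fun w => G w l)) -> (forall w l, 0 <= G w l)
    ->
  (\int[Q]_w (F w * expect (cleanw w) n.+1 V x (G w))%:E =
   \sum_e \int[Q]_w (F w * cleanw w x e *
      expect (cleanw w) n (x :: V) (x + unitvec e) (G w))%:E)%E.
Proof.
move=> mF F0 mG G0 /=.
under eq_integral do rewrite mulr_sumr -sumEFin.
rewrite ge0_integral_sum//.
- by apply: eq_bigr => e _; apply: eq_integral => w _; rewrite mulrA.
- move=> e; apply/measurable_EFinP; apply: measurable_funM => //.
  by apply: measurable_funM; [exact: measurable_clean_env|exact: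
    measurable_expect].
- move=> e w _; rewrite lee_fin mulr_ge0// mulr_ge0//.
    by have [] := clean_environment good_t0 w x.
  by apply: expect_ge0 => //; exact: clean_environment.
Qed.

(** If the walk is at time [n] at a site where it has never been, the weight
    of its path does not involve the environment at that site. In the
    induction [F] accumulates the weights of the steps already made, from the
    sites of [V]. *)
Lemma new_site_indep (A : set (transition R d.+1)) (H : site d.+1 -> bool)
    n (V : seq (site d.+1)) x (F : env -> R) :
  measurable A -> measurable_fun setT F -> (forall w, 0 <= F w) ->
  depends_only_on [set y | y \in V] F ->
  let new l := (head 0 l \notin behead l) && H (head 0 l) in
  (\int[Q]_w (F w * expect (cleanw w) n V x
     (fun l => (new l)%:R * (`[< A (w (head 0 l)) >])%:R))%:E =
   mu A * \int[Q]_w (F w * expect (cleanw w) n V x (fun l => (new l)%:R))%:E)%E.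
Proof.
move=> mA mF F0 dF new.
have mG l : measurable_fun setT
    (fun w : env => (new l)%:R * (`[< A (w (head 0 l)) >])%:R : R).
  by apply: measurable_funM => //; exact: measurable_site_indic.
elim: n V x F mF F0 dF => [|n IH] V x F mF F0 dF.
  rewrite /= /new /=; case: andP => [[xV Hx]|_]; last first.
    under eq_integral do rewrite mul0r mulr0.
    under [in RHS]eq_integral do rewrite mulr0.
    by rewrite integral0 mule0.
  have xs : rect [:: x] (fun=> A) = [set w : env | A (w x)].
    apply/seteqP; split=> w /=; first by apply; rewrite mem_head.
    by move=> Aw y; rewrite inE => /eqP ->.
  have := @integral_indep_indic [:: x] (fun=> A) F isT (fun=> mA) mF F0.
  rewrite xs (iid_marginal iidQ x mA) => h.
  under eq_integral do rewrite mul1r.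
  under [in RHS]eq_integral do rewrite mulr1.
  apply: h => w w' ww'; apply: dF => y yV; apply: ww'.
  by rewrite /= inE; apply: contraNneq xV => <-.
rewrite integral_expect_step//.
rewrite integral_expect_step//.
rewrite ge0_sume_distrr; last first.
  move=> e _; apply: integral_ge0 => w _; rewrite lee_fin mulr_ge0//
    ?mulr_ge0//.
    by have [] := clean_environment good_t0 w x.
  by apply: expect_ge0 => //; exact: clean_environment.
apply: eq_bigr => e _; apply: IH.
- by apply: measurable_funM => //; exact: measurable_clean_env.
- move=> w; rewrite mulr_ge0//; by have [] := clean_environment good_t0 w x.
move=> w w' ww'; rewrite (dF w w'); last by move=> y yV; apply: ww'; rewrite /=
  inE yV orbT.
by rewrite /clean_env ww'//= mem_head.
Qed.

(** The probability of going down is almost surely positive. *)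
Lemma exists_step_down : exists2 eta : R, 0 < eta &
  (0 < mu [set t | (eta <= clean t0 t dn)%R])%E.
Proof.
have mA (n : nat) : measurable [set t : transition R d.+1 | n.+1%:R^-1 <= clean
  t0 t dn].
  apply: measurable_le_set; first exact: measurable_cst.
  exact: measurable_clean_coord.
apply: contrapT => h.
have z n : Q [set w : env | n.+1%:R^-1 <= clean t0 (w 0) dn] = 0%E.
  rewrite (iid_marginal iidQ 0 (mA n)); apply/eqP; rewrite eq_le.
  rewrite -(iid_marginal iidQ 0 (mA n)) measure_ge0 andbT leNgt (iid_marginal
    iidQ 0 (mA n)).
  apply/negP => hn; apply: h; exists n.+1%:R^-1; last exact: hn.
  by rewrite invr_gt0 ltr0n.
have : Q setT = 0%E.
  rewrite (_ : setT = \bigcup_n [set w : env | n.+1%:R^-1 <= clean t0 (w 0)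
    dn]).
    apply/negligibleP.
      by apply: bigcup_measurable => n _; exact: (measurable_site_event 0 (mA
        n)).
    apply: negligible_bigcup => n; apply/negligibleP; last exact: z.
    exact: (measurable_site_event 0 (mA n)).
  apply/seteqP; split=> w // _.
  have [_ _ _ p _] := clean_good good_t0 (w 0).
  have [n] := ltr_add_invr p; rewrite add0r => np.
  by exists n => //=; exact: ltW.
by rewrite probability_setT => /eqP; rewrite onee_eq0.
Qed.

Definition new_below (k : int) (l : seq (site d.+1)) : bool :=
  (head 0 l \notin behead l) && (height (head 0 l) <= k).

(** At a new site of height at most [k] the transition is independent of the
    past ([new_site_indep]), so the summand of [green_bound] has there a mean
    bounded below. The expected number of such sites is therefore finite. *)
Lemma new_below_summable k :
  (\sum_(n <oo) annealed Q K [set X | new_below k (hist X n)] < +oo)%E.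
Proof.
have [eta eta0 muA] := exists_step_down.
set A := [set t | _] in muA.
have mA : measurable A.
  apply: measurable_le_set; first exact: measurable_cst.
  exact: measurable_clean_coord.
have muAE : mu A = (fine (mu A))%:E.
  by rewrite fineK// -(iid_marginal iidQ 0 mA) fin_num_measure//; exact:
    measurable_site_event.
set q := fine (mu A) in muAE.
have q0 : 0 < q by rewrite -lte_fin -muAE.
pose r : R := (4 / 3) ^ (- k).
have r0 : 0 < r by apply: exprz_gt0; lra.
pose c := r * eta * q.
have c0 : 0 < c by rewrite !mulr_gt0.
pose J n := (\int[Q]_w (expect (cleanw w) n [::] 0
    (fun l => potential R (head 0 l) * cleanw w (head 0 l) dn))%:E)%E.
have mJ n : measurable_fun setT (fun w : env => expect (cleanw w) n [::] 0
    (fun l => potential R (head 0 l) * cleanw w (head 0 l) dn)).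
  apply: measurable_expect => l; apply: measurable_funM => //.
  exact: measurable_clean_env.
have clean_ge0 w x : 0 <= cleanw w x dn by have [] := clean_environment good_t0
  w x.
have J0 n w : 0 <= expect (cleanw w) n [::] 0
    (fun l => potential R (head 0 l) * cleanw w (head 0 l) dn).
  apply: expect_ge0 => [|l]; first exact: clean_environment.
  by rewrite mulr_ge0// ltW// potential_gt0.
have step n : (annealed Q K [set X | new_below k (hist X n)] <= c^-1%:E * J
  n)%E.
  rewrite lee_pdivlMl// (annealed_hist iidQ qK mu_good good_t0).
  have h := @new_site_indep A (fun x => height x <= k) n [::] 0 (fun=> 1) mA.
  have {}h : (q%:E * \int[Q]_w (expect (cleanw w) n [::] 0 (fun l => (new_below
    k l)%:R))%:E =
    \int[Q]_w (expect (cleanw w) n [::] 0 (fun l => (new_below k l)%:R *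
       (`[< A (w (head 0 l)) >])%:R))%:E)%E.
    rewrite -muAE; have {h} := h (measurable_cst _) (fun=> ler01) (fun _ _ _ =>
      erefl).
    rewrite /=; under eq_integral do rewrite mul1r.
    by under [in RHS]eq_integral do rewrite mul1r.
  have m1 : measurable_fun setT (fun w : env => (expect (cleanw w) n [::] 0
      (fun l => (new_below k l)%:R * (`[< A (w (head 0 l)) >])%:R))%:E).
    apply/measurable_EFinP; apply: measurable_expect => l.
    by apply: measurable_funM => //; exact: measurable_site_indic.
  have p1 w : (0 <= (expect (cleanw w) n [::] 0
      (fun l => (new_below k l)%:R * (`[< A (w (head 0 l)) >])%:R))%:E)%E.
    rewrite lee_fin; apply: expect_ge0 => [|l]; first exact: clean_environment.
    by rewrite mulr_ge0.
  have re : (0 <= (r * eta)%:E)%E by rewrite lee_fin mulr_ge0 ?ltW.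
  rewrite /c EFinM -muleA h -ge0_integralZl//.
  apply: ge0_le_integral => //.
  - by move=> w _; rewrite mule_ge0.
  - by apply: emeasurable_funM => //; exact: measurable_cst.
  - exact/measurable_EFinP.
  move=> w _; rewrite -EFinM lee_fin.
  rewrite -expectZ; apply: expect_le => [|l]; first exact: clean_environment.
  rewrite /new_below.
  case: (_ \notin _); rewrite ?andTb ?andFb ?mul0r ?mulr0; last first.
    by rewrite mulr_ge0// ltW// potential_gt0.
  have [hk|] := leP (height (head 0 l)) k; last first.
    by rewrite mul0r mulr0 mulr_ge0// ltW// potential_gt0.
  case: asboolP => [Aw|_]; last by rewrite !mulr0 mulr_ge0// ltW//
    potential_gt0.
  rewrite !mulr1; apply: ler_pM; [exact: ltW|exact: ltW| |exact: Aw].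
  exact: potential_le.
apply: (@le_lt_trans _ _ (c^-1 * 6)%:E); last exact: ltry.
apply: nneseries_le_bound => [n|N]; first exact: annealed_ge0.
apply: (@le_trans _ _ (\sum_(n < N) c^-1%:E * J n)%E).
  by apply: lee_sum => n _; exact: step.
rewrite -ge0_sume_distrr; last by move=> n _; apply: integral_ge0 => w _;
  rewrite lee_fin.
rewrite EFinM lee_pmul2l// ?lte_fin ?invr_gt0//.
rewrite -ge0_integral_sum//; last 2 first.
- by move=> n; exact/measurable_EFinP.
- by move=> n w _; rewrite lee_fin.
apply: (@le_trans _ _ (\int[Q]_w (cst 6%:E w))%E); last first.
  rewrite integral_cst// [X in (_ * X)%E](_ : _ = 1%E) ?mule1//.
  exact: probability_setT.
apply: ge0_le_integral => //.
- by move=> w _; apply: sume_ge0 => n _; rewrite lee_fin.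
- by apply: emeasurable_sum => n; exact/measurable_EFinP.
move=> w _; rewrite sumEFin lee_fin; apply: green_bound.
  exact: clean_environment.
by move=> x; have [] := clean_good good_t0 (w x).
Qed.

(** In a fixed environment the weight of the site [y] in [green_bound] is a
    positive constant. This has to be quenched, since its inverse may have
    infinite mean. *)
Lemma site_visits_summable w y : is_environment w -> (forall x, good (w x)) ->
  (\sum_(n <oo) K w [set X | X n = y] < +oo)%E.
Proof.
move=> ew gw.
have p0 : 0 < potential R y * w y dn by rewrite mulr_gt0 ?potential_gt0//; have
  [] := gw y.
apply: (@le_lt_trans _ _ (((potential R y * w y dn)^-1 * 6)%:E)); last exact:
  ltry.
apply: nneseries_le_bound => // N.
have -> : (\sum_(n < N) K w [set X | X n = y] =
   (\sum_(n < N) expect w n [::] 0 (fun l => (head 0 l == y)%:R))%:E)%E.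
  rewrite -sumEFin; apply: eq_bigr => n _.
  rewrite -(@quenched_hist _ _ _ (kernel_prob K w) ew (qK ew)).
  congr (K w _); apply/seteqP; split=> X /=; rewrite (histE X n) /=.
    by move=> ->.
  by move/eqP.
rewrite lee_fin ler_pdivlMl//.
apply: le_trans (green_bound ew _ N); last by move=> x; have [] := gw x.
rewrite mulr_sumr; apply: ler_sum => n _.
rewrite -expectZ; apply: expect_le => // l.
case: eqP => [->|_]; first by rewrite mulr1.
by rewrite mulr0 mulr_ge0// ?(ew _).1// ltW// potential_gt0.
Qed.

Lemma transient_upE : @transient_up R d = \bigcap_(k in [set: nat])
  \bigcup_(N in [set: nat]) \bigcap_(n in [set n | (N <= n)%N])
    [set X | k%:Z <= height (X n)].
Proof.
apply/seteqP; split=> X.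
  move=> /cvgryPge h k _; have [N _ hN] := h k%:R.
  exists N => // n Nn; have := hN n Nn.
  by rewrite /= -[k%:R]/((k%:Z)%:~R) ler_int.
move=> h; apply/cvgryPge => A.
have [N _ hN] := h (Num.truncn `|A|).+1 I.
exists N => // n Nn; have := hN n Nn; rewrite /= -(ler_int R).
apply: le_trans; apply: le_trans (ler_norm A) _.
by apply/ltW/truncnS_gt.
Qed.

Lemma measurable_transient_up : measurable (@transient_up R d).
Proof.
rewrite transient_upE; apply: bigcap_measurable => // k _.
apply: bigcup_measurable => N _; apply: bigcap_measurable; first by exists N =>
  /=.
by move=> n _; exact: (@measurable_coord _ [set x | k%:Z <= height x]).
Qed.

(** Below a given height the walk visits finitely many sites
    ([new_below_summable]), each finitely often ([site_visits_summable]). *)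
Lemma transient_up_annealed : annealed Q K (@transient_up R d) = 1%E.
Proof.
pose N1 k := lim_sup_set (fun n => [set X : path_space d.+1 | new_below k (hist
  X n)]).
pose N2 y := lim_sup_set (fun n => [set X : path_space d.+1 | X n = y]).
have mF1 k n : measurable [set X : path_space d.+1 | new_below k (hist X n)].
  exact: (@measurable_hist _ [set l | new_below k l]).
have mlim (F : nat -> set (path_space d.+1)) : (forall n, measurable (F n)) ->
    measurable (lim_sup_set F).
  move=> mF; apply: bigcap_measurable => // n _; exact: bigcup_measurable.
have Z1 k : annealedm Q K (N1 k) = 0%E.
  by apply: lim_sup_set_cvg0; [exact: mF1|exact: new_below_summable].
have Z2 y : annealedm Q K (N2 y) = 0%E.
  apply: (annealed_quenched_null iidQ mu_good).
    by apply: mlim => n; exact: measurable_coord1.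
  move=> w ew gw; apply: lim_sup_set_cvg0; last exact: site_visits_summable.
  by move=> n; exact: measurable_coord1.
pose N := (\bigcup_k N1 k) `|` (\bigcup_y N2 y).
have mN : measurable N.
  apply: measurableU; apply: bigcup_measurable_countType => i; apply: mlim =>
    //.
  by move=> n; exact: measurable_coord1.
apply: (@annealed_eq1 _ _ _ _ _ N) => //; first exact: measurable_transient_up;
  last first.
  have : (annealedm Q K).-negligible N.
    apply: negligibleU; apply: negligible_bigcup_countType => i;
      apply/negligibleP.
    - by apply: mlim => n; exact: mF1.
    - exact: Z1.
    - by apply: mlim => n; exact: measurable_coord1.
    - exact: Z2.
  by move/negligibleP => /(_ mN).
move=> X; rewrite transient_upE => nT; apply: contrapT => nN; apply: nT => k _.
(* a site of height at most k that is visited at all is visited before n1 *)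
have [n1 h1] : exists n1, forall n, (n1 <= n)%N -> ~~ new_below k%:Z (hist X n).
  apply: contrapT => h; apply: nN; left; exists k%:Z => // n _.
  apply: contrapT => h'; apply: h; exists n => m nm; apply/negP => hm.
  by apply: h'; exists m.
have fin y : exists n2, forall n, (n2 <= n)%N -> X n != y.
  apply: contrapT => h; apply: nN; right; exists y => // n _.
  apply: contrapT => h'; apply: h; exists n => m nm; apply/eqP => hm.
  by apply: h'; exists m.
have low n : height (X n) <= k%:Z -> X n \in hist X n1.
  have [m] := ubnP n; elim: m n => // m IH n; rewrite ltnS => nm hk.
  have [nn1|n1n] := leqP n n1; first by apply/mem_hist; exists n.
  have := h1 n (ltnW n1n); rewrite /new_below histE /= hk andbT negbK.
  case: n nm n1n hk => // n nm n1n hk /= /mem_hist[j jn E].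
  rewrite E; apply: IH; first exact: leq_ltn_trans jn nm.
  by rewrite -E.
have [n2 h2] : exists n2, forall y, y \in hist X n1 -> forall n, (n2 <= n)%N ->
  X n != y.
  elim: (hist X n1) => [|y l [n2 IH]]; first by exists 0%N.
  have [n3 h3] := fin y; exists (maxn n2 n3) => z; rewrite inE => /orP[/eqP
    ->|zl] n.
    by rewrite geq_max => /andP[_]; exact: h3.
  by rewrite geq_max => /andP[n2n _]; exact: IH.
exists n2 => // n n2n /=; rewrite leNgt; apply/negP => hk.
by have := h2 _ (low _ (ltW hk)) _ n2n; rewrite eqxx.
Qed.

End transience.

(** * Exponential bounds on fast escape *)

(** Here 1 - phi = (c/2) (1 - z) sum_(j < M) z^j / (j + 1), whereas z^A >= 1 -
    A (1 - z). As the harmonic series diverges, [M] can be chosen to make the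
    sum of the 1 / (j + 1) larger than 8 A / c; then z = 1 - 1/(2M) keeps all
    the z^j at least 1/2. The slowness [A] is arbitrary: this is where the
    infinite mean of the time spent in a trap enters. *)
Lemma trap_parameters (R : realType) (c : R) (A : nat) : 0 < c <= 1 ->
  (0 < A)%N ->
  exists z : R, exists M : nat,
    let phi := 1 - \sum_(j < M) 2^-1 * (z ^+ j - z ^+ j.+1) * (c / j.+1%:R) in
    [/\ 0 < z, z <= 1, 0 <= phi & phi < z ^+ A].
Proof.
move=> /andP[c0 c1] A0.
have [M hM] : exists M : nat, 8 * A%:R / c < series (@harmonic R) M.
  apply: contrapT => h; apply: (@dvg_harmonic R).
  apply: nondecreasing_is_cvgn.
    by apply: nondecreasing_series => n _ _; exact: harmonic_ge0.
  exists (8 * A%:R / c) => _ [M _ <-]; rewrite leNgt; apply/negP => hM.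
  by apply: h; exists M.
have M0 : (0 < M)%N.
  rewrite lt0n; apply/eqP => M0; move: hM; rewrite M0 /series /= big_geq//.
  by apply/negP; rewrite -leNgt; apply: divr_ge0; [rewrite mulr_ge0|exact: ltW].
pose dl : R := (2 * M%:R)^-1.
have M1 : 1 <= M%:R :> R by rewrite ler1n.
have dl0 : 0 < dl by rewrite invr_gt0; lra.
have dl2 : dl <= 2^-1 by rewrite lef_pV2 ?posrE; lra.
have Mdl : M%:R * dl = 2^-1 by rewrite /dl; field; lra.
exists (1 - dl), M => phi.
have z0 : 0 < 1 - dl by lra.
have cjE (j : nat) : (1 - dl) ^+ j - (1 - dl) ^+ j.+1 = dl * (1 - dl) ^+ j.
  by rewrite exprS; ring.
have zj (j : nat) : (j < M)%N -> 2^-1 <= (1 - dl) ^+ j.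
  move=> jM; apply: le_trans (bernoulli_ineq j _); last by apply/andP; split;
    lra.
  have : j%:R <= M%:R :> R by rewrite ler_nat ltnW.
  by nra.
have zj1 (j : nat) : (1 - dl) ^+ j <= 1 by rewrite exprn_ile1; lra.
have phi_up : phi <= 1 - 2 * A%:R * dl.
  rewrite /phi lerB//.
  apply: (@le_trans _ _ (\sum_(j < M) 4^-1 * dl * c * harmonic j)).
    rewrite -mulr_sumr; move: hM; rewrite /series /= big_mkord => /ltW hM.
    have := ler_wpM2l (ltW dl0) hM; rewrite -(ler_pM2l c0).
    have -> : c * (dl * (8 * A%:R / c)) = 8 * A%:R * dl by field; lra.
    by move=> ?; lra.
  apply: ler_sum => j _; rewrite cjE /=.
  have -> : 4^-1 * dl * c / j.+1%:R = 2^-1 * (dl * 2^-1) * (c / j.+1%:R) by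
    field.
  apply: ler_wpM2r; first by rewrite divr_ge0// ltW.
  apply: ler_wpM2l => //; apply: ler_wpM2l; first exact: ltW.
  exact/zj/ltn_ord.
split=> //.
- by lra.
- rewrite subr_ge0.
  apply: (@le_trans _ _ (\sum_(j < M) 2^-1 * dl)); last first.
    by rewrite sumr_const card_ord -[leLHS]mulr_natl mulrCA Mdl; lra.
  apply: ler_sum => j _; rewrite cjE -mulrA ler_wpM2l//.
  rewrite -[leRHS]mulr1; apply: ler_pM.
  - by rewrite mulr_ge0 ?exprn_ge0 ?ltW.
  - by rewrite divr_ge0// ltW.
  - by rewrite -[leRHS]mulr1 ler_wpM2l// ltW.
  by rewrite ler_pdivrMr ?ltr0n// mul1r (le_trans c1)// ler1n.
apply: (le_lt_trans phi_up); apply: (@lt_le_trans _ _ (1 - A%:R * dl)).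
  have : 1 <= A%:R :> R by rewrite ler1n.
  by move=> A1; nra.
by apply: bernoulli_ineq; apply/andP; split; lra.
Qed.

Section slow_escape.
Variables (R : realType) (d : nat) (Q : probability (environment R d.+1) R).
Variable K : R.-pker (environment R d.+1) ~> (path_space d.+1).
Variable mu : set (transition R d.+1) -> \bar R.
Hypothesis iidQ : iid_environment mu Q.
Hypothesis qK : quenched_kernel K.
Hypothesis mu_good : mu (@good R d) = 1%E.
Variable t0 : transition R d.+1.
Hypothesis good_t0 : good t0.
Local Notation env := (environment R d.+1).
Local Notation cleanw w := (clean_env t0 w).

Variable L : site d.+1 -> int.
Hypothesis L_block : forall y x, x \in block y -> L x = L y.
Hypothesis L_step : forall x e, L (x + unitvec e) <= L x + 1.
Hypothesis L0 : L 0 = 0.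

(** When the walk first reaches level [k], it has not yet left any site of the
    block where it is, so whether this block is a trap is independent of the
    past. The induction is that of [new_site_indep]. *)
Lemma hit_indep (z q : R) (k : int) (A : site d.+1 -> set (transition R d.+1))
    n x (F : env -> R) :
  0 <= z <= 1 -> 0 <= q -> (forall y, measurable (A y)) ->
  (forall y, (q%:E <= Q (rect (block y) A))%E) ->
  measurable_fun setT F -> (forall w, 0 <= F w) ->
  depends_only_on [set y | ~~ above L k y] F ->
  (q%:E * \int[Q]_w (F w * hit (cleanw w) z n (above L k) (fun=> 1) x)%:E <=
   \int[Q]_w (F w * hit (cleanw w) z n (above L k)
                (fun y => (`[< rect (block y) A w >])%:R) x)%:E)%E.
Proof.
move=> z01 q0 mA Aq.
have z0 : 0 <= z by case/andP: z01.
have mI y : measurable_fun setT (fun w : env => (`[< rect (block y) A w >])%:R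
  : R).
  rewrite (_ : (fun w => _) = \1_(rect (block y) A)).
    by apply/measurable_indicP; exact: measurable_rect.
  by apply/funext => w; rewrite indicE; congr (_%:R); apply/asboolP; rewrite
    ?inE.
have start n' y (F' : env -> R) : above L k y -> measurable_fun setT F' ->
    (forall w, 0 <= F' w) -> depends_only_on [set y | ~~ above L k y] F' ->
    (q%:E * \int[Q]_w (F' w * hit (cleanw w) z n' (above L k) (fun=> 1) y)%:E <=
     \int[Q]_w (F' w * hit (cleanw w) z n' (above L k)
                  (fun y => (`[< rect (block y) A w >])%:R) y)%:E)%E.
  move=> ky mF F0 dF; under eq_integral do rewrite hit_in// mulr1.
  under [leRHS]eq_integral do rewrite hit_in//.
  rewrite (integral_indep_indic iidQ (block_uniq y) mA mF F0).
    by rewrite lee_wpmul2r// integral_ge0// => w _; rewrite lee_fin.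
  move=> w w' ww'; apply: dF => x' kx'; apply: ww' => /=.
  by apply: contra kx' => /L_block x'y; rewrite /above x'y.
elim: n x F => [|n IH] x F mF F0 dF; have [kx|kx] := boolP (above L k x);
  try exact: start.
  rewrite /= (negbTE kx); under eq_integral do rewrite mulr0.
  by rewrite integral0 mule0.
have we w e : 0 <= cleanw w x e by have [] := clean_environment good_t0 w x.
have split (f : env -> site d.+1 -> R) :
    (forall y, measurable_fun setT (fun w => f w y)) ->
    (forall w y, 0 <= f w y) ->
    (\int[Q]_w (F w * hit (cleanw w) z n.+1 (above L k) (f w) x)%:E =
     \sum_e \int[Q]_w (z * F w * cleanw w x e *
        hit (cleanw w) z n (above L k) (f w) (x + unitvec e))%:E)%E.
  move=> mf f0; rewrite /= (negbTE kx).
  under eq_integral do rewrite mulrCA mulrA mulr_sumr -sumEFin.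
  rewrite ge0_integral_sum//.
  - by apply: eq_bigr => e _; apply: eq_integral => w _; rewrite !mulrA.
  - move=> e; apply/measurable_EFinP; apply: measurable_funM.
      by apply: measurable_funM.
    by apply: measurable_funM; [exact: measurable_clean_env|exact:
      measurable_hit].
  - move=> e w _; rewrite lee_fin mulr_ge0// ?mulr_ge0//.
    by apply: hit_ge0 => //; exact: clean_environment.
rewrite (split (fun _ _ => 1))// (split (fun w y => (`[< rect (block y) A w
  >])%:R))//.
rewrite ge0_sume_distrr; last first.
  move=> e _; apply: integral_ge0 => w _; rewrite lee_fin !mulr_ge0//.
  by apply: hit_ge0 => //; exact: clean_environment.
apply: lee_sum => e _; apply: IH.
- by apply: measurable_funM; [apply: measurable_funM|exact:
  measurable_clean_env].
- by move=> w; rewrite !mulr_ge0.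
move=> w w' ww'; rewrite (dF w w')//; congr (_ * _).
by rewrite /clean_env ww'.
Qed.

Lemma measurable_trapping (a : R) (x : site d.+1) :
  measurable [set t : transition R d.+1 | trapping a x (clean t0 t)].
Proof.
apply: measurable_le_set; first exact: measurable_cst.
under eq_fun do rewrite big_mkcond.
apply: measurable_sum => e.
by have [_|_] := boolP (inward x e);
  [exact: measurable_clean_coord|exact: measurable_cst].
Qed.

(** The average of [hit_markov] with the bound of [hit_block] as [g]: between
    levels [k] and [k + 1] the discount loses a factor that does not depend on
    [k]. *)
Lemma integral_hit_recursion (z c : R) (k : int) n M : 0 <= z <= 1 -> 0 <= c ->
  (forall y j, ((c / j.+1%:R)%:E <= Q (rect (block y)
     (fun x => [set t | trapping (2 * j.+1%:R)^-1 x (clean t0 t)])))%E) ->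
  0 <= k ->
  (\int[Q]_w (hit (cleanw w) z n (above L (k + 1)) (fun=> 1) 0)%:E +
   (\sum_(j < M) 2^-1 * (z ^+ j - z ^+ j.+1) * (c / j.+1%:R))%:E *
     \int[Q]_w (hit (cleanw w) z n (above L k) (fun=> 1) 0)%:E <=
   \int[Q]_w (hit (cleanw w) z n (above L k) (fun=> 1) 0)%:E)%E.
Proof.
move=> z01 c0 hq k0; have /andP[z0 z1] := z01.
pose A j := fun x : site d.+1 =>
  [set t : transition R d.+1 | trapping (2 * j.+1%:R)^-1 x (clean t0 t)].
have mA j y : measurable (A j y) by exact: measurable_trapping.
pose tr (w : env) j y : R := (`[< rect (block y) (A j) w >])%:R.
have trE w j y : tr w j y =
    (all (fun x => trapping (2 * j.+1%:R)^-1 x (cleanw w x)) (block y))%:R.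
  rewrite /tr; congr (nat_of_bool _)%:R; apply/idP/idP.
    by move=> /asboolP h; apply/allP => x; exact: h.
  by move=> /allP h; apply/asboolP => x; exact: h.
have mtr j y : measurable_fun setT (fun w => tr w j y).
  rewrite (_ : (fun w => _) = \1_(rect (block y) (A j))).
    by apply/measurable_indicP; exact: measurable_rect.
  by apply/funext => w; rewrite indicE /tr; congr (_%:R); apply/asboolP;
    rewrite ?inE.
pose cj (j : nat) : R := 2^-1 * (z ^+ j - z ^+ j.+1).
have cj0 j : 0 <= cj j.
  by rewrite mulr_ge0// subr_ge0 exprS ler_piMl// exprn_ge0.
pose H k w := hit (cleanw w) z n (above L k) (fun=> 1) 0.
have mH k' : measurable_fun setT (H k') by apply: measurable_hit.
have H0 k' w : 0 <= H k' w by apply: hit_ge0 => //; exact: clean_environment.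
have mT j : measurable_fun setT (fun w => cj j * hit (cleanw w) z n (above L k)
  (tr w j) 0).
  by apply: measurable_funM => //; apply: measurable_hit.
have T0 j w : 0 <= cj j * hit (cleanw w) z n (above L k) (tr w j) 0.
  by rewrite mulr_ge0//; apply: hit_ge0 => //; exact: clean_environment.
have quenched w : H (k + 1) w +
    \sum_(j < M) cj j * hit (cleanw w) z n (above L k) (tr w j) 0 <= H k w.
  rewrite -lerBrDr -hit_lin; apply: hit_markov => //.
  - exact: clean_environment.
  - move=> m y Ly; have := @hit_block _ _ _ (clean_environment good_t0 w) z z01
    L L_block y m M.
    rewrite Ly => /le_trans; apply; rewrite lerB// ler_sum// => j _.
    by rewrite trE.
  - by rewrite L0.
apply: (@le_trans _ _ (\int[Q]_w ((H (k + 1) w)%:E +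
   (\sum_(j < M) cj j * hit (cleanw w) z n (above L k) (tr w j) 0)%:E))%E);
     last first.
  apply: ge0_le_integral; first exact: measurableT.
  - by move=> w _; rewrite -EFinD lee_fin addr_ge0// sumr_ge0.
  - by apply/measurable_EFinP; apply: measurable_funD => //; apply:
    measurable_sum.
  - by apply/measurable_EFinP; exact: (mH k).
  - by move=> w _; rewrite -EFinD lee_fin.
rewrite ge0_integralD//; last 4 first.
- by move=> w _; rewrite lee_fin.
- exact/measurable_EFinP.
- by move=> w _; rewrite lee_fin sumr_ge0.
- by apply/measurable_EFinP; apply: measurable_sum.
apply: leeD => //.
under [leRHS]eq_integral do rewrite -sumEFin.
rewrite ge0_integral_sum//; last 2 first.
- by move=> j; exact/measurable_EFinP.
- by move=> j w _; rewrite lee_fin.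
rewrite -sumEFin ge0_sume_distrl; last first.
  by move=> j _; rewrite lee_fin; apply: mulr_ge0; [exact: (cj0 j)|exact:
    divr_ge0].
apply: lee_sum => j _.
under [leRHS]eq_integral do rewrite EFinM.
rewrite ge0_integralZl//; last 3 first.
- by apply/measurable_EFinP; apply: measurable_hit.
- by move=> w _; rewrite lee_fin; apply: hit_ge0 => //; exact:
  clean_environment.
- by rewrite lee_fin.
rewrite EFinM -muleA; apply: lee_wpmul2l; first by rewrite lee_fin; exact: (cj0
  j).
have qj : 0 <= c / j.+1%:R by exact: divr_ge0.
have := @hit_indep z (c / j.+1%:R) k (A j) n 0 (fun=> 1) z01 qj (mA j)
  (fun y => hq y j) (measurable_cst _) (fun=> ler01) (fun _ _ _ => erefl).
have one (f : env -> R) : (\int[Q]_w (1 * f w)%:E = \int[Q]_w (f w)%:E)%E.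
  by apply: eq_integral => w _; rewrite mul1r.
by rewrite !one.
Qed.

Lemma integral_hit_geometric (z c : R) n M (k : nat) : 0 <= z <= 1 -> 0 <= c ->
  (forall y j, ((c / j.+1%:R)%:E <= Q (rect (block y)
     (fun x => [set t | trapping (2 * j.+1%:R)^-1 x (clean t0 t)])))%E) ->
  let phi := 1 - \sum_(j < M) 2^-1 * (z ^+ j - z ^+ j.+1) * (c / j.+1%:R) in
  0 <= phi ->
  (\int[Q]_w (hit (cleanw w) z n (above L k%:Z) (fun=> 1) 0)%:E <=
     (phi ^+ k)%:E)%E.
Proof.
move=> z01 c0 hq phi phi0.
have h1 k' : (\int[Q]_w (hit (cleanw w) z n (above L k') (fun=> 1) 0)%:E <=
  1)%E.
  apply: (@le_trans _ _ (\int[Q]_w (cst 1%:E w))%E); last first.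
    rewrite integral_cst// [X in (_ * X)%E](_ : _ = 1%E) ?mule1//.
    exact: probability_setT.
  apply: ge0_le_integral => //.
  - by move=> w _; rewrite lee_fin; apply: hit_ge0 => //; exact:
    clean_environment.
  - by apply/measurable_EFinP; apply: measurable_hit.
  - by move=> w _; rewrite lee_fin; apply: hit_le1 => //; exact:
    clean_environment.
elim: k => [|k IH]; first exact: h1.
have := @integral_hit_recursion z c k%:Z n M z01 c0 hq isT.
have -> : k%:Z + 1 = k.+1%:Z by lia.
have fin k' : (\int[Q]_w (hit (cleanw w) z n (above L k') (fun=> 1) 0)%:E)%E
  \is a fin_num.
  rewrite ge0_fin_numE; first exact: le_lt_trans (h1 k') (ltry _).
  by apply: integral_ge0 => w _; rewrite lee_fin; apply: hit_ge0 => //; exact: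
    clean_environment.
rewrite -(fineK (fin k)) -(fineK (fin k.+1)) in IH *.
rewrite -EFinM -EFinD !lee_fin exprS => h.
apply: le_trans (ler_wpM2l phi0 IH); rewrite /phi; lra.
Qed.

(** The probability of reaching level [k] by time [A k] is at most z^(- A k)
    phi^k, which is summable as phi < z^A. *)
Lemma annealed_above (c : R) (A : nat) : 0 < c ->
  (forall y j, ((c / j.+1%:R)%:E <= Q (rect (block y)
     (fun x => [set t | trapping (2 * j.+1%:R)^-1 x (clean t0 t)])))%E) ->
  (0 < A)%N ->
  annealed Q K (lim_sup_set (fun k : nat =>
    [set X | has (above L k%:Z) (hist X (A * k)%N)])) = 0%E.
Proof.
move=> c0 hq A0.
have c1 : c <= 1.
  rewrite -lee_fin -[c]divr1; apply: le_trans (hq 0 0%N) _.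
  apply: probability_le1; apply: measurable_rect => y; exact:
    measurable_trapping.
have [z [M]] := @trap_parameters R c A (introT andP (conj c0 c1)) A0.
set phi := 1 - _ => -[z0 z1 phi0 phiz].
have z01 : 0 <= z <= 1 by rewrite ltW.
apply: (@lim_sup_set_cvg0 _ _ _ (annealedm Q K)) => [k|].
  exact: (@measurable_hist _ [set l | has (above L k%:Z) l]).
pose r := phi / z ^+ A.
have zA : 0 < z ^+ A by rewrite exprn_gt0.
have r0 : 0 <= r by rewrite divr_ge0// ltW.
have r1 : r < 1 by rewrite ltr_pdivrMr// mul1r.
have bound (k : nat) : (annealed Q K [set X | has (above L k%:Z) (hist X (A *
  k)%N)]
    <= (r ^+ k)%:E)%E.
  rewrite (@annealed_hist _ _ _ _ _ iidQ qK mu_good _ good_t0 (has (above L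
    k%:Z))).
  have zAk : 0 < z ^+ (A * k) by rewrite exprn_gt0.
  rewrite /r expr_div_n -exprM mulrC EFinM lee_pdivlMl//.
  rewrite -ge0_integralZl//; last 3 first.
  - by apply/measurable_EFinP; apply: measurable_expect => l; exact:
    measurable_cst.
  - by move=> w _; rewrite lee_fin; apply: expect_ge0 => //; exact:
    clean_environment.
  - by rewrite lee_fin ltW.
  apply: le_trans (integral_hit_geometric (A * k) k z01 (ltW c0) hq phi0).
  apply: ge0_le_integral => //.
  - move=> w _; apply: mule_ge0; rewrite lee_fin; first exact: ltW.
    by apply: expect_ge0 => //; exact: clean_environment.
  - apply: emeasurable_funM; first exact: measurable_cst.
    by apply/measurable_EFinP; apply: measurable_expect => l; exact:
      measurable_cst.
  - by apply/measurable_EFinP; apply: measurable_hit.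
  - move=> w _; rewrite -EFinM lee_fin; apply: expect_hit => //.
    exact: clean_environment.
apply: (@le_lt_trans _ _ ((1 - r)^-1)%:E); last exact: ltry.
apply: nneseries_le_bound => [n|N]; first exact: annealed_ge0.
apply: (@le_trans _ _ (\sum_(k < N) (r ^+ k)%:E)%E).
  by apply: lee_sum => k _; exact: bound.
rewrite sumEFin lee_fin -[leRHS]mul1r ler_pdivlMr ?subr_gt0//.
have -> : (\sum_(k < N) r ^+ k) * (1 - r) = 1 - r ^+ N.
  by apply: oppr_inj; rewrite opprB subrX1; ring.
by rewrite gerBl exprn_ge0.
Qed.

End slow_escape.

(** * Zero velocity *)

Section velocity.
Variables (R : realType) (D : nat).

Lemma row_norm_le (v : 'rV[R]_D) (e : R) : 0 <= e ->
  `|v| <= e <-> forall i, `|v 0 i| <= e.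
Proof.
move=> e0; rewrite /Num.norm /= mx_normrE; split.
  by move=> /bigmax_leP[_ h] i; exact: (h (0, i)).
move=> h; apply/bigmax_leP; split=> [|[i j] _]; first exact: e0.
by rewrite /= (ord1 i); exact: h.
Qed.

(** In this form the event is a countable combination of conditions on one
    position, hence measurable. *)
Lemma zero_velocityE : @zero_velocity R D = \bigcap_(m in [set: nat])
  \bigcup_(N in [set: nat]) \bigcap_(n in [set n | (N <= n)%N])
    [set X : path_space D | forall i, m%:Z * `|X n 0 i| <= n%:Z].
Proof.
have key (X : path_space D) n m i : (0 < n)%N -> (0 < m)%N ->
    (m%:Z * `|X n 0 i| <= n%:Z) =
    (`|((n%:R^-1 : R) *: map_mx intr (X n)) 0 i| <= m%:R^-1).
  move=> n0 m0; rewrite !mxE normrM gtr0_norm ?invr_gt0 ?ltr0n//.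
  rewrite ler_pdivrMl ?ltr0n// ler_pdivlMr ?ltr0n// mulrC.
  by rewrite -intr_norm -[m%:R]/(m%:Z%:~R) -[n%:R]/(n%:Z%:~R) -intrM ler_int.
apply/seteqP; split=> X.
  move=> /cvgr0Pnorm_le h m _; case: m => [|m].
    by exists 0%N => // n _ i; rewrite mul0r.
  have [|N _ hN] := h m.+1%:R^-1; first by rewrite invr_gt0 ltr0n.
  exists N.+1 => // n /= Nn i; rewrite key//; last exact: leq_ltn_trans Nn.
  have := hN n (ltnW Nn) => /row_norm_le; apply.
  by rewrite invr_ge0.
move=> h; apply/cvgr0Pnorm_le => e e0.
have [N _ hN] := h (Num.truncn e^-1).+1 I.
exists N.+1 => // n /= Nn; apply/row_norm_le => [|i]; first exact: ltW.
apply: (@le_trans _ _ (Num.truncn e^-1).+1%:R^-1).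
  rewrite -key//; last exact: leq_ltn_trans Nn.
  by apply: hN; exact: ltnW.
by rewrite invf_ple ?posrE ?ltr0n// ltW// truncnS_gt.
Qed.

Lemma measurable_zero_velocity : measurable (@zero_velocity R D).
Proof.
rewrite zero_velocityE; apply: bigcap_measurable => // m _.
apply: bigcup_measurable => N _; apply: bigcap_measurable; first by exists N =>
  /=.
by move=> n _; exact: (@measurable_coord _
  [set x | forall i, m%:Z * `|x 0 i| <= n%:Z]).
Qed.

End velocity.

Section zero_velocity.
Variables (R : realType) (d : nat) (Q : probability (environment R d.+1) R).
Variable K : R.-pker (environment R d.+1) ~> (path_space d.+1).
Variable mu : set (transition R d.+1) -> \bar R.
Hypothesis iidQ : iid_environment mu Q.
Hypothesis qK : quenched_kernel K.
Hypothesis mu_good : mu (@good R d) = 1%E.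
Variable t0 : transition R d.+1.
Hypothesis good_t0 : good t0.

(** Levels along the [2 (d + 1)] signed axes. Dividing by 2 makes them
    constant on blocks, so that a whole block is unexplored when its level is
    first reached. *)
Definition half_level (i : 'I_d.+1) (s : bool) (x : site d.+1) : int :=
  if s then (x 0%R i %/ 2)%Z else - (x 0%R i %/ 2)%Z.

Lemma half_level_block i s y x : x \in block y ->
  half_level i s x = half_level i s y.
Proof. by move=> xy; rewrite /half_level (block_half i xy). Qed.

Lemma half_level_step i s x e :
  half_level i s (x + unitvec e) <= half_level i s x + 1.
Proof.
rewrite /half_level mxE unitvecE.
by case: s; case: (i == e.1); case: (e.2) => //=; lia.
Qed.

Lemma half_level0 i s : half_level i s 0 = 0.
Proof. by rewrite /half_level mxE; case: s. Qed.

(** By [annealed_above] every level eventually stays below n / A, for every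
    [A]. *)
Lemma zero_velocity_annealed (c : R) : 0 < c ->
  (forall y j, ((c / j.+1%:R)%:E <= Q (rect (block y)
     (fun x => [set t | trapping (2 * j.+1%:R)^-1 x (clean t0 t)])))%E) ->
  annealed Q K (@zero_velocity R d.+1) = 1%E.
Proof.
move=> c0 hq.
pose E (a : nat * 'I_d.+1 * bool) := lim_sup_set (fun k : nat =>
    [set X : path_space d.+1 |
      has (above (half_level a.1.2 a.2) k%:Z) (hist X (a.1.1.+1 * k)%N)]).
have mE a : measurable (E a).
  apply: bigcap_measurable => // n _; apply: bigcup_measurable => k _.
  exact: (@measurable_hist _ [set l | has (above _ _) l]).
have zE a : annealedm Q K (E a) = 0%E.
  apply: (annealed_above iidQ qK mu_good good_t0 _ _ _ c0 hq) => //.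
  - by move=> y x; exact: half_level_block.
  - by move=> x e; exact: half_level_step.
  - exact: half_level0.
pose N := \bigcup_a E a.
have mN : measurable N by exact: bigcup_measurable_countType.
apply: (@annealed_eq1 _ _ _ _ _ N) => //; first exact:
  measurable_zero_velocity; last first.
  have : (annealedm Q K).-negligible N.
    by apply: negligible_bigcup_countType => a; apply/negligibleP; [exact:
      mE|exact: zE].
  by move/negligibleP => /(_ mN).
move=> X; rewrite zero_velocityE => nV; apply: contrapT => nN; apply: nV => m _.
have slow a : exists k0, forall k, (k0 <= k)%N ->
    ~~ has (above (half_level a.1.2 a.2) k%:Z) (hist X (a.1.1.+1 * k)%N).
  apply: contrapT => h; apply: nN; exists a => // n _.
  apply: contrapT => h'; apply: h; exists n => k nk; apply/negP => hk.
  by apply: h'; exists k.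
(* [L <= n / A] for both signs gives |x_i| <= 2 (n / A) + 1; with
   A = 4 m + 1 this is at most n / m as soon as n >= 2 m *)
pose A := (4 * m).+1.
have slow2 i s : exists n0, forall n, (n0 <= n)%N ->
    half_level i s (X n) <= (n %/ A)%N%:Z.
  have [k0 h] := slow (4 * m, i, s)%N; exists (A * k0)%N => n n0.
  have := h (n %/ A).+1; rewrite ltnW; last first.
    by rewrite ltnS leq_divRL// mulnC.
  move=> /(_ isT) /hasPn /(_ (X n)) hX.
  have := hX _; rewrite /above -ltNge -ltz1D addrC.
  have -> : (n %/ A).+1%:Z = (n %/ A)%N%:Z + 1 by lia.
  apply; apply/mem_hist; exists n => //=.
  by rewrite mulnC; apply/ltnW/ltn_ceil.
have [n0 hn0] : exists n0, forall i s n, (n0 <= n)%N ->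
    half_level i s (X n) <= (n %/ A)%N%:Z.
  have /choice[f hf] : forall a : 'I_d.+1 * bool, exists n0, forall n,
      (n0 <= n)%N -> half_level a.1 a.2 (X n) <= (n %/ A)%N%:Z.
    by case=> i s; exact: slow2.
  exists (\max_a f a) => i s n hn; apply: (hf (i, s)).
  exact: leq_trans (leq_bigmax _) hn.
exists (n0 + 2 * m)%N => // n /= hn i.
have n0n : (n0 <= n)%N by apply: leq_trans hn; rewrite leq_addr.
have := hn0 i true n n0n; have := hn0 i false n n0n; rewrite /half_level.
have hA : (n %/ A * A <= n)%N by exact: leq_trunc_div.
have : (2 * m <= n)%N by apply: leq_trans hn; rewrite leq_addl.
move: hA; rewrite /A; set q := (n %/ _)%N; set x := X n 0 i => hA hm h1 h2.
have hx : `|x| <= 2 * q%:Z + 1 by lia.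
have : (4 * (m * q) <= n)%N by nia.
move=> h4; apply: (@le_trans _ _ (m%:Z * (2 * q%:Z + 1))); first by rewrite
  ler_wpM2l.
nia.
Qed.

End zero_velocity.

(** * The law of the transitions in the model *)

Section marginal.
Variables (R : realType) (d : nat).
Notation up := ((ord_max, true) : dir d.+1).
Notation dn := ((ord_max, false) : dir d.+1).
Local Notation hz i := (widen_ord (leqnSn d) i).

Lemma sum_dir (V : nmodType) (F : dir d.+1 -> V) : \sum_e F e =
  \sum_(i < d) (F (hz i, true) + F (hz i, false)) + (F up + F dn).
Proof.
transitivity (\sum_i \sum_b F (i, b)).
  by rewrite pair_big /=; apply: eq_bigr => -[].
have b2 (G : bool -> V) : \sum_b G b = G true + G false.
  by rewrite (bigD1 true)// (bigD1 false)//= big1 ?addr0// => -[].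
by under eq_bigr do rewrite b2; rewrite big_ord_recr.
Qed.

Lemma hz_max (i : 'I_d) : (hz i == ord_max) = false.
Proof. by apply/eqP => /(congr1 val) /= /eqP; rewrite ltn_eqF. Qed.

Lemma in_signset_hz (s : {ffun 'I_d -> bool}) i b : ((hz i, b) \in signset s) =
  (b == s i).
Proof.
apply/imsetP/eqP => [[j _ [ij ->]]|->]; last by exists i.
by congr (s _); apply: val_inj; rewrite /= -ij.
Qed.

Lemma in_signset_max (s : {ffun 'I_d -> bool}) b : ((ord_max, b) : dir d.+1)
  \in signset s = false.
Proof.
apply/imsetP => -[j _ [jd _]].
by have := ltn_ord j; rewrite -[X in (X < _)%N]jd ltnn.
Qed.

Lemma signset_inj : injective (@signset d).
Proof.
move=> s s' ss'; apply/ffunP => i.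
by apply/eqP; rewrite -in_signset_hz -ss' in_signset_hz.
Qed.

Lemma ex_weight_hz (t : R) (s : {ffun 'I_d -> bool}) i b :
  ex_weight t (signset s) (hz i, b) = if b == s i then t else 1 - t.
Proof.
rewrite /ex_weight in_signset_hz; case: eqP => // bs.
rewrite /oppdir /= in_signset_hz; case: eqP => //.
by move: bs; case: b; case: (s i).
Qed.

Lemma ex_weight_max (t : R) (s : {ffun 'I_d -> bool}) b :
  ex_weight t (signset s) (ord_max, b) = if b then 2 * t else t.
Proof.
by rewrite /ex_weight /oppdir !in_signset_max !xpair_eqE !eqxx /=; case: b.
Qed.

Lemma ex_normE (t : R) (s : {ffun 'I_d -> bool}) : ex_norm t (signset s) = d%:R
  + 3 * t.
Proof.
rewrite /ex_norm sum_dir !ex_weight_max (eq_bigr (fun=> 1)) => [|i _].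
  by rewrite sumr_const card_ord; ring.
by rewrite !ex_weight_hz; case: (s i) => /=; ring.
Qed.

Hypothesis d0 : (0 < d)%N.

(** The normalizing constant is [d + 3 t] whatever the signs are, so no
    weight, being at most 1, yields a probability above [1 / d]. *)
Lemma good_ex_transition (t : R) (s : {ffun 'I_d -> bool}) : 0 < t -> t <= 2^-1
  ->
  good (ex_transition t (signset s)).
Proof.
move=> t0 t2; have d1 : 1 <= d%:R :> R by rewrite ler1n.
have n0 : 0 < d%:R + 3 * t by lra.
have wb e : 0 <= ex_weight t (signset s) e <= 1.
  by rewrite /ex_weight; do ![case: ifP => _]; lra.
split=> [e||||e]; rewrite /ex_transition.
- by apply: divr_ge0; [case/andP: (wb e)|rewrite ex_normE ltW].
- by rewrite -mulr_suml -/(ex_norm _ _) ex_normE mulfV// gt_eqF.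
- by rewrite !ex_weight_max mulrA.
- by rewrite ex_weight_max divr_gt0// ex_normE.
- rewrite ex_normE ler_pdivrMr// mulrDr mulVf; last by lra.
  have /andP[_ h] := wb e; apply: (le_trans h).
  by rewrite lerDl mulr_ge0 ?invr_ge0//; lra.
Qed.

(** These signs point out of the block, so that each of the [d] inward
    directions has weight [1 - t]; and d (1 - t) / (d + 3 t) >= 1 - 4 t. *)
Lemma trapping_ex_transition (t a : R) (x : site d.+1) : 0 < t -> 4 * t <= a ->
  trapping a x (ex_transition t (signset [ffun i => odd_coord x (hz i)])).
Proof.
move=> t0 ta; have d1 : 1 <= d%:R :> R by rewrite ler1n.
have n0 : 0 < d%:R + 3 * t by lra.
rewrite /trapping big_mkcond sum_dir /inward /= !eqxx /= addr0 addr0.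
rewrite (eq_bigr (fun=> (1 - t) / (d%:R + 3 * t))) => [|i _].
  rewrite sumr_const card_ord -[leRHS]mulr_natl mulrA ler_pdivlMr//.
  have : 0 <= (a - 4 * t) * (d%:R + 3 * t) by apply: mulr_ge0; lra.
  have : 0 <= t * (d%:R - 1) by apply: mulr_ge0; lra.
  have : 0 <= t * t by apply: mulr_ge0; lra.
  by lra.
rewrite !hz_max /= /ex_transition !ex_weight_hz ex_normE !ffunE.
by case: odd_coord; rewrite /= ?addr0 ?add0r.
Qed.

Lemma measurable_ex_transition (B : {set dir d.+1}) :
  measurable_fun setT (fun t : R => ex_transition t B).
Proof.
apply: measurable_fun_prod => e; rewrite /ex_transition.
have mw e' : measurable_fun setT (fun t : R => ex_weight t B e').
  rewrite /ex_weight; have [_|_] := boolP (e' \in B); first exact: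
    measurable_id.
  have [_|_] := boolP (oppdir e' \in B); first exact: measurable_funB.
  have [_|_] := boolP (e' == up); first exact: measurable_funM.
  by have [_|_] := boolP (e' == dn).
apply: measurable_funM => //; apply: measurable_funV_real.
exact: measurable_sum.
Qed.

Variables (disp : measure_display) (Omega : measurableType disp).
Variables (Pr : probability Omega R) (T : {RV Pr >-> R}).
Variable B0 : Omega -> {set dir d.+1}.
Hypothesis exv : ex_variables T B0.

Lemma measurable_ex_preimage (A : set (transition R d.+1)) : measurable A ->
  measurable [set o | A (ex_transition (T o) (B0 o))].
Proof.
move=> mA.
rewrite (_ : [set o | _] = \bigcup_B
   (B0 @^-1` [set B] `&` T @^-1` [set t | A (ex_transition t B)])).
  apply: bigcup_measurable_countType => B; apply: measurableI.
    exact: ex_B0_measurable exv _.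
  rewrite -[X in measurable X]setTI; apply: measurable_funPT => //.
  rewrite -[X in measurable X]setTI.
  exact: (measurable_ex_transition B measurableT mA).
apply/seteqP; split=> o /=; first by move=> h; exists (B0 o).
by move=> [B _ [/= -> ]].
Qed.

Lemma ex_marginal_good : ex_marginal T B0 (@good R d) = 1%E.
Proof.
rewrite /ex_marginal /pushforward.
have mT (A : set R) : measurable A -> measurable (T @^-1` A).
  by move=> mA; rewrite -[X in measurable X]setTI; exact: measurable_funPT.
have mB (S : set {set dir d.+1}) : measurable (B0 @^-1` S) := ex_B0_measurable
  exv S.
pose G := (fun o => ex_transition (T o) (B0 o)) @^-1` @good R d.
have mG : measurable G by exact: measurable_ex_preimage (@measurable_good R d).
pose E1 := [set o | 0 < T o]; pose E2 := [set o | T o <= 2^-1].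
pose E3 := B0 @^-1` (range (@signset d)).
have m1 : measurable E1.
  have -> : E1 = T @^-1` `]0, +oo[%classic.
    by apply/seteqP; split=> o; rewrite /= in_itv /= andbT.
  exact: mT.
have m2 : measurable E2.
  have -> : E2 = T @^-1` `]-oo, 2^-1]%classic.
    by apply/seteqP; split=> o; rewrite /= in_itv.
  exact: mT.
have m3 : measurable E3 by exact: mB.
have P3 : Pr E3 = 1%E.
  have -> : E3 = \bigcup_s (B0 @^-1` [set signset s]).
    by apply/seteqP; split=> o [s _ /= E]; exists s.
  rewrite measure_bigcup_finType//.
    rewrite (eq_bigr (fun=> ((2 ^ d)%:R^-1 : R)%:E)); last first.
      by move=> s _; exact: (ex_B0_uniform exv s).
    rewrite sumEFin sumr_const card_ffun card_bool card_ord -[X in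
      X%:E]mulr_natl.
    by rewrite mulfV// pnatr_eq0 -lt0n expn_gt0.
  apply/trivIsetP => s s' _ _ ss'; apply/seteqP; split=> o //= [-> /signset_inj
    E].
  by rewrite E eqxx in ss'.
have c0 E : measurable E -> Pr E = 1%E -> Pr.-negligible (~` E).
  move=> mE PE; apply/negligibleP; first exact: measurableC.
  by have := probability_setC Pr mE; rewrite PE subee.
have /negligibleP nG : Pr.-negligible (~` G).
  apply: (@negligibleS _ _ _ _ (~` E1 `|` (~` E2 `|` ~` E3))).
    move=> o nGo; rewrite -!setCI => -[h1 [h2 [s _ h3]]]; apply: nGo.
    by rewrite /G /preimage /= -h3; exact: good_ex_transition.
  apply: negligibleU; first exact: c0 m1 (ex_T_pos exv).
  by apply: negligibleU; [exact: c0 m2 (ex_T_le_half exv)|exact: c0 m3 P3].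
have := probability_setC Pr (measurableC mG); rewrite setCK nG ?sube0//.
exact: measurableC.
Qed.

Variable t0 : transition R d.+1.
Variable Q : probability (environment R d.+1) R.
Hypothesis iidQ : iid_environment (ex_marginal T B0) Q.

(** A block is a trap as soon as each of its 2^d sites has T <= 1 / n, with n
    = 8 (j + 1), and signs pointing outwards. The exponent 1 / 2^d of the tail
    of T makes the product of these probabilities of order 1 / n. *)
Lemma block_trapping : exists2 c : R, 0 < c &
  forall y j, ((c / j.+1%:R)%:E <= Q (rect (block y)
     (fun x => [set t | trapping (2 * j.+1%:R)^-1 x (clean t0 t)])))%E.
Proof.
have [c c0 hc] := ex_T_tail exv.
pose N := (2 ^ d)%N; have N0 : (0 < N)%N by rewrite expn_gt0.
exists ((c * N%:R^-1) ^+ N / 8).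
  by rewrite divr_gt0// exprn_gt0// mulr_gt0// invr_gt0 ltr0n.
move=> y j; have QE := iidQ (block_uniq y)
  (fun x => measurable_trapping t0 (2 * j.+1%:R)^-1 x).
apply: (@le_trans _ _ (\prod_(x <- block y) ex_marginal T B0
  [set t | trapping (2 * j.+1%:R)^-1 x (clean t0 t)])%E); last by rewrite -QE.
pose n := (8 * j.+1)%N.
pose p : R := (c * n%:R `^ (- N%:R^-1)) * N%:R^-1.
have p0 : 0 <= p by do 2?[apply: mulr_ge0] => //; exact: ltW.
have -> : (c * N%:R^-1) ^+ N / 8 / j.+1%:R = p ^+ size (block y).
  have pw : (n%:R `^ (- N%:R^-1)) ^+ N = n%:R^-1 :> R.
    rewrite -powR_mulrn ?powR_ge0// -powRrM mulNr mulVf ?powR_inv1//.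
    by rewrite pnatr_eq0 -lt0n.
  rewrite size_block -/N /p !exprMn pw natrM invfM.
  by ring.
apply: prode_ge => // x.
rewrite /ex_marginal /pushforward.
set s : {ffun 'I_d -> bool} := [ffun i => odd_coord x (hz i)].
pose E := T @^-1` `]0, n%:R^-1]%classic `&` B0 @^-1` [set signset s].
have mE : measurable E.
  apply: measurableI; last exact: ex_B0_measurable exv _.
  by rewrite -[X in measurable X]setTI; exact: measurable_funPT.
have nR : 0 < n%:R :> R by rewrite ltr0n.
have PE : (p%:E <= Pr E)%E.
  rewrite /E (ex_independent exv)// (ex_B0_uniform exv) /p EFinM.
  rewrite lee_pmul2r ?lte_fin ?invr_gt0 ?ltr0n//.
  have -> : T @^-1` `]0, n%:R^-1]%classic = [set o | n%:R <= (T o)^-1].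
    apply/seteqP; split=> o; rewrite /= in_itv /=.
      by move=> /andP[To Tn]; rewrite -[n%:R]invrK lef_pV2 ?posrE ?invr_gt0.
    move=> h; have Ti : 0 < (T o)^-1 by exact: lt_le_trans nR h.
    have To : 0 < T o by rewrite -invr_gt0.
    by rewrite To /= -[T o]invrK lef_pV2 ?posrE ?invr_gt0.
  by apply: hc; rewrite muln_gt0.
apply: (le_trans PE); apply: le_measure; rewrite ?inE//.
  by apply: (measurable_ex_preimage (A := [set t | trapping _ x (clean t0
    t)])); exact: measurable_trapping.
move=> o [/=]; rewrite in_itv /= => /andP[To Tn] Bo.
have j1 : 1 <= j.+1%:R :> R by rewrite ler1n.
have nE : n%:R^-1 = 8^-1 * j.+1%:R^-1 :> R by rewrite natrM invfM.
have ji : j.+1%:R^-1 <= 1 :> R by rewrite invf_le1// ltr0n.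
have ji0 : 0 < j.+1%:R^-1 :> R by rewrite invr_gt0 ltr0n.
rewrite Bo clean_id; last first.
  apply: good_ex_transition => //; move: Tn; rewrite nE => h.
  apply: le_trans h _; move: ji ji0; generalize (j.+1%:R^-1 : R) => v v1 v0.
  by lra.
apply: trapping_ex_transition => //; move: Tn; rewrite nE invfM => h.
apply: le_trans (ler_wpM2l (ler0n R 4) h) _; rewrite mulrA.
by apply: ler_wpM2r; [exact: ltW|lra].
Qed.

End marginal.

(** * Stays on two sites *)

Section two_sites.
Variables (R : realType) (d : nat) (Q : probability (environment R d.+1) R).
Variable K : R.-pker (environment R d.+1) ~> (path_space d.+1).
Variable mu : set (transition R d.+1) -> \bar R.
Hypothesis iidQ : iid_environment mu Q.
Hypothesis qK : quenched_kernel K.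
Hypothesis mu_good : mu (@good R d) = 1%E.
Variable t0 : transition R d.+1.
Hypothesis good_t0 : good t0.

Lemma alternates_hist (X : nat -> site d.+1) i k :
  (forall j, (i <= j < i + k)%N -> X j.+2 = X j) ->
  alternates k (hist X (i.+1 + k)).
Proof.
elim: k => [//|k IH] h.
have hk : alternates k (hist X (i.+1 + k)).
  apply: IH => j /andP[ij jk]; apply: h; rewrite ij /=.
  by rewrite addnS ltnW// ltnS.
move: hk; rewrite addnS addSn /= (histE X (i + k)) => ->.
by rewrite andbT; apply/eqP/h; rewrite leq_addr addnS ltnSn.
Qed.

(** The steps being nonzero this has probability zero. It is set apart because
    a trajectory that rests could stay on two sites without alternating. *)
Definition idle : set (path_space d.+1) :=
  \bigcup_(n in [set: nat]) [set X | X n.+1 = X n].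

Lemma measurable_idle1 n : measurable [set X : path_space d.+1 | X n.+1 = X n].
Proof.
rewrite (_ : [set X | _] =
    [set X : path_space d.+1 | nth 0 (hist X n.+1) 0 = nth 0 (hist X n.+1) 1]).
  exact: (@measurable_hist _ [set l | nth 0 l 0 = nth 0 l 1]).
by apply/seteqP; split=> X; rewrite /= (histE X n).
Qed.

Lemma annealed_idle : annealed Q K idle = 0%E.
Proof.
apply: (annealed_quenched_null iidQ mu_good).
  by apply: bigcup_measurable => n _; exact: measurable_idle1.
move=> w ew gw.
have : (K w).-negligible idle.
  apply: negligible_bigcup => n; apply/negligibleP; first exact:
    measurable_idle1.
  pose G (l : seq (site d.+1)) := nth 0 l 0 == nth 0 l 1.
  transitivity (kernel_prob K w [set X | G (hist X n.+1)]).
    congr (K w _); apply/seteqP; split=> X; rewrite /G /= (histE X n) /=.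
      by move=> ->.
    by move/eqP.
  rewrite (@quenched_hist _ _ _ (kernel_prob K w) ew (qK ew)) expect_last;
    congr EFin.
  rewrite -[RHS](expect_cst ew n [::] 0 0); apply: eq_expect => l.
  rewrite big1// => e _; rewrite /G; case: l => [|x l] /=; last first.
    rewrite -subr_eq0 addrAC subrr add0r.
    case: eqP => [/(congr1 (fun v : site d.+1 => v 0 e.1))|]; last by rewrite
      mulr0.
    by rewrite unitvecE eqxx mxE; case: e.2.
  rewrite add0r; case: eqP => [/(congr1 (fun v : site d.+1 => v 0 e.1))|]; last
    by rewrite mulr0.
  by rewrite unitvecE eqxx mxE; case: e.2.
move/negligibleP; apply; apply: bigcup_measurable => n _; exact:
  measurable_idle1.
Qed.

Lemma card_two (U : Type) (S : set U) a b c : (S #= `I_2)%card ->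
  S a -> S b -> S c -> a <> b -> b <> c -> a = c.
Proof.
move=> /card_set_bijP[f [fS finj _]] Sa Sb Sc ab bc.
have inS x : S x -> x \in S by move=> ?; rewrite inE.
apply: (finj a c (inS _ Sa) (inS _ Sc)).
have fab : f a <> f b by move=> /(finj a b (inS _ Sa) (inS _ Sb)).
have fbc : f b <> f c by move=> /(finj b c (inS _ Sb) (inS _ Sc)).
have := fS a Sa; have := fS b Sb; have := fS c Sc; rewrite /=.
by lia.
Qed.

Definition window (i : nat) (c : R) : set nat :=
  [set j | (i <= j)%N /\ j%:R <= i%:R + c].

Lemma windowE i c j : 0 <= c ->
  window i c j <-> (i <= j <= i + Num.truncn c)%N.
Proof.
move=> c0; rewrite /window /=.
have key : (i <= j)%N -> (j%:R <= i%:R + c) = (j <= i + Num.truncn c)%N.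
  move=> ij; rewrite -leq_subLR (truncn_ge_nat _ c0) natrB//.
  by rewrite lerBlDl.
by split=> [[ij]|/andP[ij]]; [rewrite (key ij) ij|rewrite -(key ij)].
Qed.

Lemma two_site_alternates (C : R) n (X : path_space d.+1) : 0 <= C * ln n%:R ->
  two_site_stay C n X -> ~ idle X ->
  exists2 i, (i <= n)%N & alternates (Num.truncn (C * ln n%:R)).-1
    (hist X (i.+1 + (Num.truncn (C * ln n%:R)).-1)).
Proof.
move=> c0 [i iN S2] nI; exists i => //; apply: alternates_hist => j /andP[ij
  jk].
have move1 l : X l.+1 <> X l by move=> E; apply: nI; exists l.
set m := Num.truncn _ in jk *.
have inS l : (i <= l <= i + m)%N ->
    [set X j | j in window i (C * ln n%:R)] (X l).
  by move=> il; exists l => //; apply/windowE.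
have jm : (j.+2 <= i + m)%N by case: (m) jk => [|m'] /=; lia.
apply: (card_two S2) (move1 j.+1) (move1 j); apply: inS; lia.
Qed.

Lemma measurable_two_site_stay (C : R) n : 0 <= C * ln n%:R ->
  measurable (two_site_stay C n : set (path_space d.+1)).
Proof.
move=> c0; set m := Num.truncn (C * ln n%:R).
rewrite (_ : two_site_stay C n = \bigcup_(i in [set i | (i <= n)%N])
  [set X : path_space d.+1 | ([set nth 0 (hist X (i + m)) (i + m - j)%N |
     j in window i (C * ln n%:R)] #= `I_2)%card]).
  apply: bigcup_measurable => i _.
  exact: (@measurable_hist _ [set l | ([set nth 0 l (i + m - j)%N |
     j in window i (C * ln n%:R)] #= `I_2)%card]).
have E (X : path_space d.+1) i : [set X j | j in window i (C * ln n%:R)] =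
    [set nth 0 (hist X (i + m)) (i + m - j)%N | j in window i (C * ln n%:R)].
  apply/seteqP; split=> x [j wj <-]; exists j => //;
    move/(windowE _ _ c0): wj => /andP[_ jm];
    by rewrite nth_hist ?leq_subr// subKn.
by apply/seteqP; split=> X [i iN /= h]; exists i => //=; move: h; rewrite -E.
Qed.

Lemma annealed_two_site_bound (C : R) n : (2 <= d)%N -> 0 <= C * ln n%:R ->
  (annealed Q K (two_site_stay C n) <=
     (n.+1%:R * 2^-1 ^+ (Num.truncn (C * ln n%:R)).-1)%:E)%E.
Proof.
move=> d2 c0; set k := (Num.truncn _).-1.
pose F i := [set X : path_space d.+1 | alternates k (hist X (i.+1 + k))].
have mF i : measurable (F i).
  exact: (@measurable_hist _ [set l | alternates k l]).
have mU : measurable (\big[setU/set0]_(i < n.+1) F i).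
  by apply: bigsetU_measurable => i _; exact: mF.
have mI : measurable idle.
  by apply: bigcup_measurable => i _; exact: measurable_idle1.
apply: (@le_trans _ _ (annealedm Q K (idle `|` \big[setU/set0]_(i < n.+1) F
  i))).
  apply: (@le_measure _ _ _ (annealedm Q K)); rewrite ?inE.
  - exact: measurable_two_site_stay.
  - exact: measurableU.
  move=> X hX; have [iX|nI] := pselect (idle X); first by left.
  have [i iN hi] := two_site_alternates c0 hX nI.
  right; rewrite -bigcup_mkord; exists i => //=.
apply: (@le_trans _ _ (annealedm Q K idle +
    annealedm Q K (\big[setU/set0]_(i < n.+1) F i))%E).
  exact: (@measureU2 _ _ _ (annealedm Q K)).
rewrite [X in (X + _)%E](annealed_idle : _ = _) add0e.
apply: (@le_trans _ _ (\sum_(i < n.+1) annealedm Q K (F i))%E).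
  by apply: (@Boole_inequality _ _ _ (annealedm Q K)) => i _; exact: mF.
apply: (@le_trans _ _ (\sum_(i < n.+1) (2^-1 ^+ k)%:E)%E); last first.
  by rewrite sumEFin sumr_const card_ord mulr_natl.
apply: lee_sum => i _.
rewrite [leLHS](@annealed_hist _ _ _ _ _ iidQ qK mu_good _ good_t0 (alternates
  k)).
apply: (@le_trans _ _ (\int[Q]_w (cst (2^-1 ^+ k)%:E w))%E); last first.
  rewrite integral_cst// [X in (_ * X)%E](_ : _ = 1%E) ?mule1//.
  exact: probability_setT.
apply: ge0_le_integral => //.
- by move=> w _; rewrite lee_fin; apply: expect_ge0 => //; exact:
  clean_environment.
- apply/measurable_EFinP; apply: measurable_expect => l; exact: measurable_cst.
- move=> w _; rewrite lee_fin; apply: alternates_bound; first exact: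
  clean_environment.
  move=> x e; have [_ _ _ _ h] := clean_good good_t0 (w x).
  apply: (le_trans (h e)); rewrite lef_pV2 ?posrE ?ltr0n//.
    by rewrite ler_nat.
  exact: ltn_trans d2.
Qed.

Lemma half_exp_pred m : 2^-1 ^+ m.-1 <= 4 * 2^-1 ^+ m.+1 :> R.
Proof.
case: m => [|m] /=; first by rewrite expr0 expr1; lra.
by rewrite !exprS; lra.
Qed.

(** With this constant 2^(C ln n) = n^2, which beats the [n.+1] starting
    times. *)
Lemma two_site_cvg : (2 <= d)%N ->
  annealed Q K (two_site_stay (2 / ln 2 : R) n) @[n --> \oo] --> 0%E.
Proof.
move=> d2; have l2 : 0 < ln 2 :> R by rewrite ln_gt0// ltr1n.
have bound (n : nat) : (0 < n)%N ->
    (annealed Q K (two_site_stay (2 / ln 2 : R) n) <= (8 * n%:R^-1 : R)%:E)%E.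
  move=> n0; have n1 : 1 <= n%:R :> R by rewrite ler1n.
  have c0 : 0 <= 2 / ln 2 * ln n%:R :> R.
    by rewrite mulr_ge0 ?ln_ge0// divr_ge0// ltW.
  apply: (le_trans (annealed_two_site_bound d2 c0)); rewrite lee_fin.
  have tr := truncnS_gt (2 / ln 2 * ln n%:R : R).
  set m := Num.truncn _ in tr *.
  have two : n%:R ^+ 2 <= 2 ^+ m.+1 :> R.
    rewrite -[leLHS]lnK ?posrE ?exprn_gt0 ?ltr0n// -[leRHS]lnK ?posrE
      ?exprn_gt0//.
    rewrite ler_expR !lnXn ?ltr0n// -[leLHS]mulr_natl -[leRHS]mulr_natl.
    have := ler_wpM2r (ltW l2) (ltW tr).
    by rewrite mulrAC divfK ?gt_eqF.
  have half : 2^-1 ^+ m.-1 <= 4 / n%:R ^+ 2 :> R.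
    apply: (@le_trans _ _ (4 * 2^-1 ^+ m.+1)).
      exact: half_exp_pred.
    rewrite ler_wpM2l// exprVn lef_pV2 ?posrE ?exprn_gt0 ?ltr0n//.
  apply: le_trans (ler_wpM2l (ler0n R n.+1) half) _.
  have nn : n%:R != 0 :> R by rewrite pnatr_eq0 -lt0n.
  rewrite -natr1 expr2 invfM.
  have -> : (n%:R + 1) * (4 * (n%:R^-1 * n%:R^-1)) = 4 * n%:R^-1 + 4 * (n%:R^-1
    * n%:R^-1) :> R.
    by field.
  have v1 : n%:R^-1 <= 1 :> R by rewrite invf_le1// ltr0n.
  have v0 : 0 < n%:R^-1 :> R by rewrite invr_gt0 ltr0n.
  have vv : n%:R^-1 * n%:R^-1 <= n%:R^-1 :> R by rewrite ler_piMl// ltW.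
  have -> : 8 * n%:R^-1 = 4 * (n%:R^-1 + n%:R^-1) :> R by ring.
  by rewrite -mulrDr ler_wpM2l// lerD2l.
apply: (@squeeze_cvge _ _ _ _ (cst 0%E) _ (fun n => (8 * n%:R^-1 : R)%:E)).
- exists 1%N => // n /= n0; rewrite annealed_ge0/=; exact: bound.
- exact: cvg_cst.
- apply: cvg_EFin; first by apply: nearW.
  rewrite -(mulr0 8); apply: cvgMr.
  by rewrite -cvg_shiftS; exact: cvg_harmonic.
Qed.

End two_sites.

Theorem proposition4p4 (R : realType) (d : nat) (hd : (1 <= d)%N) :
  (forall (disp : measure_display) (Omega : measurableType disp)
      (Pr : probability Omega R) (T : {RV Pr >-> R})
      (B0 : Omega -> {set dir d.+1})
      (Qex : probability (environment R d.+1) R)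
      (K : R.-pker (environment R d.+1) ~> (path_space d.+1)),
    ex_variables T B0 ->
    iid_environment (ex_marginal T B0) Qex ->
    quenched_kernel K ->
    annealed Qex K (@transient_up R d) = 1%E /\
    annealed Qex K (@zero_velocity R d.+1) = 1%E) /\
  ((2 <= d)%N ->
   exists C : R, 0 < C /\
   forall (disp : measure_display) (Omega : measurableType disp)
      (Pr : probability Omega R) (T : {RV Pr >-> R})
      (B0 : Omega -> {set dir d.+1})
      (Qex : probability (environment R d.+1) R)
      (K : R.-pker (environment R d.+1) ~> (path_space d.+1)),
    ex_variables T B0 ->
    iid_environment (ex_marginal T B0) Qex ->
    quenched_kernel K ->
    annealed Qex K (two_site_stay C n) @[n --> \oo] --> 0%E).
Proof.
(* any transition of the model can replace the bad ones *)
pose s : {ffun 'I_d -> bool} := [ffun=> true].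
have good_t0 : good (ex_transition (2^-1 : R) (signset s)).
  by apply: good_ex_transition => //; rewrite invr_gt0.
split.
  move=> disp Omega Pr T B0 Q K exv iidQ qK.
  have mu_good := ex_marginal_good hd exv.
  have [c c0 hc] := block_trapping hd exv
    (ex_transition (2^-1 : R) (signset s)) iidQ.
  split; first exact: (transient_up_annealed iidQ qK mu_good good_t0).
  exact: (zero_velocity_annealed iidQ qK mu_good good_t0 c0 hc).
move=> d2; exists (2 / ln 2); split.
  by rewrite divr_gt0// ln_gt0// ltr1n.
move=> disp Omega Pr T B0 Q K exv iidQ qK.
exact: (two_site_cvg iidQ qK (ex_marginal_good hd exv) good_t0 d2).
Qed.
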